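(* Let $M^2$ be a PMC totally real surface in a complex space form $N^n(c)$, with nowhere vanishing mean curvature vector field $H$ and Gaussian curvature $K$. Write $JH=T+N$ with $T$ the tangential part and $N$ the normal part. Then $\nabla T=A_N$ and $$-\frac12\Delta|T|^2=K|T|^2+|A_N|^2 .$$
   Context: A surface is an oriented manifold of real dimension $2$. A complex space form $N^n(c)$ is a Kähler manifold of complex dimension $n$, with complex structure $J$, and constant holomorphic sectional curvature $c$. For a submanifold (isometric immersion) $M^2$ of $N^n(c)$, $\nabla$ is the Levi-Civita connection of $M$, $B$ the second fundamental form, $H=\frac12\operatorname{trace}B$ the mean curvature vector field, $\nabla^\perp$ the normal connection, and $A_V$ the shape operator in the normal direction $V$, $\langle A_VX,Y\rangle=\langle B(X,Y),V\rangle$. $M$ is PMC if $\nabla^\perp H=0$, and totally real if $J(TM)$ is contained in the normal bundle of $M$. The identity $\nabla T=A_N$ means $\nabla_XT=A_NX$ for all tangent $X$. The sign convention is $\Delta=-\operatorname{trace}\nabla^2$. (In $JH=T+N$, $N$ denotes a normal vector field, not the ambient manifold.) *)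

(* Defs.v *)
From HB Require Import structures.
From mathcomp Require Export all_boot all_order all_algebra.
From mathcomp Require Export all_classical all_reals all_analysis.
Export numFieldNormedType.Exports.

Set Implicit Arguments.
Unset Strict Implicit.
Unset Printing Implicit Defensive.

Import Order.TTheory GRing.Theory Num.Theory.
Local Open Scope classical_set_scope.
Local Open Scope ring_scope.

(* Conventions.  Tangent vectors in a chart are row vectors, so a linear map   *)
(* acts by right multiplication and the differential of f at x is              *)
(* v |-> 'D_v f x = v *m jacobian f x.  Tensor fields on a manifold are given  *)
(* classically, by their components in every chart of the atlas.               *)

(* C^k on the open set U: for k.+1, f is Frechet differentiable on U and each  *)
(* directional derivative 'D_v f is of class C^k on U.                         *)
Fixpoint Ck_on (R : realType) (V W : normedModType R) (k : nat) (U : set V)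
    (f : V -> W) : Prop :=
  match k with
  | 0 => forall x, U x -> {for x, continuous f}
  | k'.+1 => (forall x, U x -> differentiable f x) /\
             (forall v, Ck_on k' U ('D_v f))
  end.

Definition smooth_on (R : realType) (V W : normedModType R) (U : set V)
    (f : V -> W) : Prop := forall k, Ck_on k U f.

(* A metric on an open set of R^m is a matrix-valued function g, g x being its *)
(* Gram matrix at x in the standard frame e_0, ..., e_(m-1).                   *)

Section LocalGeometry.
Variables (R : realType) (m : nat).
Implicit Types (g : 'rV[R]_m -> 'M[R]_m) (x v w z : 'rV[R]_m).

Definition frame (i : 'I_m) : 'rV[R]_m := delta_mx 0 i.

Definition inner g x v w : R := (v *m g x *m w^T) 0 0.

Definition normsq g x v : R := inner g x v v.

(* The Levi-Civita Christoffel symbols as a bilinear map: by Koszul's formula  *)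
(* for the constant fields v, w, e_l,                                          *)
(* 2 <Gamma(v,w), e_l> = v<w,e_l> + w<v,e_l> - e_l<v,w>.                       *)
Definition christoffel g x v w : 'rV[R]_m :=
  2^-1 *: ((\row_l ('D_v (fun y => inner g y w (frame l)) x
                  + 'D_w (fun y => inner g y v (frame l)) x
                  - 'D_(frame l) (fun y => inner g y v w) x))
           *m invmx (g x)).

Definition cov g (X : 'rV[R]_m -> 'rV[R]_m) v x : 'rV[R]_m :=
  'D_v X x + christoffel g x v (X x).

(* R(v,w)z = nabla_v nabla_w z - nabla_w nabla_v z - nabla_[v,w] z, where      *)
(* v, w, z are extended to constant fields, so that [v,w] = 0.                 *)
Definition curvature g x v w z : 'rV[R]_m :=
  cov g (fun y => cov g (fun=> z) w y) v x
  - cov g (fun y => cov g (fun=> z) v y) w x.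

Definition sectional g x v w : R :=
  inner g x (curvature g x v w w) v
  / (normsq g x v * normsq g x w - inner g x v w ^+ 2).

(* (nabla^2 u)(v,w) = v(w u) - (nabla_v w) u *)
Definition hessian g (u : 'rV[R]_m -> R) x v w : R :=
  'D_v ('D_w u) x - 'D_(christoffel g x v w) u x.

(* Delta = - trace nabla^2 *)
Definition laplacian g (u : 'rV[R]_m -> R) x : R :=
  - \sum_i \sum_j invmx (g x) i j * hessian g u x (frame i) (frame j).

(* The squared norm |A|^2 = trace (A^* A) of an endomorphism A of the tangent  *)
(* space at x.                                                                 *)
Definition normsq_end g x (A : 'rV[R]_m -> 'rV[R]_m) : R :=
  \sum_i \sum_j invmx (g x) i j * inner g x (A (frame i)) (A (frame j)).

End LocalGeometry.

(* F is an isometric immersion from the metric g to the metric h.  A vector    *)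
(* field along F is a function V : R^m -> R^k, V x being a tangent vector of   *)
(* the target at F x.                                                          *)

Section LocalSubmanifold.
Variables (R : realType) (m k : nat).
Variables (g : 'rV[R]_m -> 'M[R]_m) (h : 'rV[R]_k -> 'M[R]_k).
Variable F : 'rV[R]_m -> 'rV[R]_k.
Implicit Types (V : 'rV[R]_m -> 'rV[R]_k) (x v w : 'rV[R]_m).

(* The Levi-Civita connection of the target, pulled back along F.              *)
Definition cov_along V v x : 'rV[R]_k :=
  'D_v V x + christoffel h (F x) ('D_v F x) (V x).

(* The tangent vector t of the source with <t, e_j> = <V, dF e_j> for all j,   *)
(* so that dF t is the tangential part of V.                                   *)
Definition tangent_part V x : 'rV[R]_m :=
  (\row_j inner h (F x) (V x) ('D_(frame R j) F x)) *m invmx (g x).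

Definition normal_part V x : 'rV[R]_k := V x - 'D_(tangent_part V x) F x.

(* B(v,w) is the normal part of nabla_v (dF w).                                *)
Definition second_form v w x : 'rV[R]_k :=
  normal_part (fun y => cov_along ('D_w F) v y) x.

(* H = (trace B) / 2; the normalisation is the one of surfaces, m = 2.         *)
Definition mean_curvature x : 'rV[R]_k :=
  2^-1 *: \sum_i \sum_j
    invmx (g x) i j *: second_form (frame R i) (frame R j) x.

(* The normal connection (nabla^perp_v V)(x), for V normal.                    *)
Definition normal_cov V v x : 'rV[R]_k :=
  normal_part (fun y => cov_along V v y) x.

(* The vector A_V v with <A_V v, e_j> = <B(v, e_j), V> for all j.              *)
Definition shape V x v : 'rV[R]_m :=
  (\row_j inner h (F x) (second_form v (frame R j) x) (V x)) *m invmx (g x).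

End LocalSubmanifold.

Record chart (R : realType) (m : nat) (M : topologicalType) := Chart {
  dom : set M;
  img : set 'rV[R]_m;
  coord : M -> 'rV[R]_m;
  param : 'rV[R]_m -> M;
  dom_open : open dom;
  img_open : open img;
  coord_img : forall p, dom p -> img (coord p);
  param_dom : forall x, img x -> dom (param x);
  coordK : forall p, dom p -> param (coord p) = p;
  paramK : forall x, img x -> coord (param x) = x;
  coord_continuous : forall p, dom p -> {for p, continuous coord};
  param_continuous : forall x, img x -> {for x, continuous param} }.

Definition overlap (R : realType) (m : nat) (M : topologicalType)
    (a b : chart R m M) : set 'rV[R]_m :=
  [set x | img a x /\ dom b (param a x)].

Definition transition (R : realType) (m : nat) (M : topologicalType)
    (a b : chart R m M) (x : 'rV[R]_m) : 'rV[R]_m := coord b (param a x).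

Record manifold (R : realType) (m : nat) := Manifold {
  carrier :> topologicalType;
  atlas : set (chart R m carrier);
  carrier_hausdorff : hausdorff_space carrier;
  carrier_second_countable : @second_countable carrier;
  atlas_cover : forall p : carrier, exists2 a, atlas a & dom a p;
  atlas_smooth : forall a b, atlas a -> atlas b ->
    smooth_on (overlap a b) (transition a b) }.

Record metric (R : realType) (m : nat) (M : manifold R m) := Metric {
  gram :> chart R m M -> 'rV[R]_m -> 'M[R]_m;
  gram_sym : forall a x, atlas a -> img a x -> (gram a x)^T = gram a x;
  gram_pos : forall a x v, atlas a -> img a x -> v != 0 ->
    0 < inner (gram a) x v v;
  gram_smooth : forall a, atlas a -> smooth_on (img a) (gram a);
  gram_transition : forall a b x v w, atlas a -> atlas b -> overlap a b x ->
    inner (gram a) x v w =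
    inner (gram b) (transition a b x)
      ('D_v (transition a b) x) ('D_w (transition a b) x) }.

Record surface (R : realType) := Surface {
  surface_manifold :> manifold R 2;
  surface_metric : metric surface_manifold;
  surface_oriented : forall (a b : chart R 2 surface_manifold) x,
    atlas a -> atlas b -> overlap a b x -> 0 < \det (jacobian (transition a b) x) }.

(* Multiplication by i on C^n = R^n + iR^n: (x, y) |-> (-y, x).                *)
Definition Jmx (R : realType) (n : nat) : 'M[R]_(n + n) :=
  block_mx 0 1%:M (- 1%:M) 0.

(* A complex manifold (the transition maps satisfy the Cauchy-Riemann          *)
(* equations, so that J has matrix Jmx in every chart) with a Hermitian metric *)
(* whose fundamental form omega(v,w) = <Jv,w> is closed.                       *)
Record kahler (R : realType) (n : nat) := Kahler {
  kahler_manifold :> manifold R (n + n);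
  kahler_holomorphic : forall (a b : chart R (n + n) kahler_manifold) x,
    atlas a -> atlas b -> overlap a b x ->
    Jmx R n *m jacobian (transition a b) x
      = jacobian (transition a b) x *m Jmx R n;
  kahler_metric : metric kahler_manifold;
  kahler_hermitian : forall (a : chart R (n + n) kahler_manifold) x v w,
    atlas a -> img a x ->
    inner (kahler_metric a) x (v *m Jmx R n) (w *m Jmx R n)
      = inner (kahler_metric a) x v w;
  kahler_closed : forall (a : chart R (n + n) kahler_manifold) x u v w,
    atlas a -> img a x ->
    let omega v w y := inner (kahler_metric a) y (v *m Jmx R n) w in
    'D_u (omega v w) x + 'D_v (omega w u) x + 'D_w (omega u v) x = 0 }.

Definition complex_space_form (R : realType) (n : nat) (N : kahler R n)
    (c : R) : Prop :=
  forall (a : chart R (n + n) N) x v, atlas a -> img a x -> v != 0 ->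
    sectional (kahler_metric N a) x v (v *m Jmx R n) = c.

Section Immersions.
Variables (R : realType) (n : nat) (M : surface R) (N : kahler R n).

Definition local_expr (f : M -> N) (a : chart R 2 M) (b : chart R (n + n) N)
    (x : 'rV[R]_2) : 'rV[R]_(n + n) := coord b (f (param a x)).

Definition local_dom (f : M -> N) (a : chart R 2 M) (b : chart R (n + n) N) :
    set 'rV[R]_2 :=
  [set x | [/\ atlas a, atlas b, img a x & dom b (f (param a x))]].

(* Since the metric of M is positive definite, the isometry condition implies *)
(* that f is an immersion.                                                     *)
Record isometric_immersion := IsometricImmersion {
  immersion_fun :> M -> N;
  immersion_continuous : continuous immersion_fun;
  immersion_smooth : forall a b,
    smooth_on (local_dom immersion_fun a b) (local_expr immersion_fun a b);
  immersion_isometric : forall a b x v w, local_dom immersion_fun a b x ->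
    inner (surface_metric M a) x v w =
    inner (kahler_metric N b) (local_expr immersion_fun a b x)
      ('D_v (local_expr immersion_fun a b) x)
      ('D_w (local_expr immersion_fun a b) x) }.

Variables (f : isometric_immersion).
Variables (a : chart R 2 M) (b : chart R (n + n) N).

Local Notation gM := (surface_metric M a).
Local Notation gN := (kahler_metric N b).
Local Notation F := (local_expr f a b).

Definition gauss_curvature x : R :=
  sectional gM x (frame R (0 : 'I_2)) (frame R (1 : 'I_2)).

Definition H_field : 'rV[R]_2 -> 'rV[R]_(n + n) := mean_curvature gM gN F.

Definition JH_field x : 'rV[R]_(n + n) := H_field x *m Jmx R n.

(* JH = T + N *)
Definition T_field : 'rV[R]_2 -> 'rV[R]_2 := tangent_part gM gN F JH_field.

Definition N_field : 'rV[R]_2 -> 'rV[R]_(n + n) := normal_part gM gN F JH_field.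

Definition A_N x : 'rV[R]_2 -> 'rV[R]_2 := shape gM gN F N_field x.

End Immersions.

Definition PMC (R : realType) (n : nat) (M : surface R) (N : kahler R n)
    (f : isometric_immersion M N) : Prop :=
  forall a b x v, local_dom f a b x ->
    normal_cov (surface_metric M a) (kahler_metric N b) (local_expr f a b)
      (H_field f a b) v x = 0.

Definition totally_real (R : realType) (n : nat) (M : surface R)
    (N : kahler R n) (f : isometric_immersion M N) : Prop :=
  forall a b x v w, local_dom f a b x ->
    inner (kahler_metric N b) (local_expr f a b x)
      ('D_v (local_expr f a b) x *m Jmx R n) ('D_w (local_expr f a b) x) = 0.

(* Main.v *)
Require Import Defs.
From mathcomp Require Import ring lra.
Import Order.TTheory GRing.Theory Num.Theory.
Set Implicit Arguments.
Unset Strict Implicit.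
Unset Printing Implicit Defensive.
Local Open Scope classical_set_scope.
Local Open Scope ring_scope.

(** Why it holds.  Fix a pair of charts.  Since the ambient manifold is Kaehler,
    J is parallel, so the ambient derivative of JH along X is J applied to that of
    H.  The latter is tangent, because H is parallel in the normal bundle, and J
    maps tangent vectors to normal ones, because M is totally real.  Hence JH = T + N
    has normal derivative.  Its tangential part is [nabla_X T - A_N X], by the
    formulas of Gauss (for T) and Weingarten (for N), whence [nabla T = A_N]
    ([cov_along_JH_normal], [cov_tangent_part]).

    As A_N is self-adjoint, the 1-form dual to T is closed; and
    [div T = tr A_N = 2 <H, N> = 2 <H, JH> - 2 <H, T> = 0] ([div_tangent_JH]).
    For a closed and divergence-free field, commuting second covariant derivatives
    gives Bochner's formula [- Delta |T|^2 / 2 = Ric(T, T) + |nabla T|^2]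
    ([bochner]), and on a surface [Ric(T, T) = K |T|^2] ([ricci_surface]).

    The computations are done in a chart, with matrices.  The Christoffel symbols of
    g in the direction u form a matrix [connection_mx g u x], written Gamma_u here,
    such that [nabla_u w = w Gamma_u] for a constant field w.  The connection is
    metric when [D_u g = Gamma_u g + g Gamma_u^T] and torsion-free when
    [w Gamma_u = u Gamma_w]; curvature, second fundamental form and second covariant
    derivative become polynomials in such matrices and their derivatives.  What
    this needs from analysis is that smooth maps are stable under products,
    inversion of matrices and composition, so that every field in sight is smooth,
    and that second derivatives are symmetric. *)

(** * Maps of class C^k *)

Section FrechetCalculus.
Variables (R : realType) (V : normedModType R).

Lemma differentiable_near0 (W : normedModType R) (f : V -> W) x :
  (\forall y \near x, f y = 0) -> differentiable f x.
Proof.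
move=> f0.
have fx : f x = 0 by exact: nbhs_singleton f0.
have e : f \o shift x = cst (f x) + (\0 : V -> W) +o_ (0 : V) id.
  apply/eqaddoP => e e0; rewrite /= fx.
  have : \forall y \near (0 : V), f (y + x) = 0.
    by move/nbhs0P: f0; apply: filterS => y; rewrite addrC.
  apply: filterS => y /= fy.
  rewrite [X in `|X|](_ : _ = f (y + x) - (0 + 0)) // fy addr0 subrr normr0.
  by rewrite mulr_ge0 // ltW.
have d := @diff_unique _ _ _ f \0 x (@cst_continuous _ _ _) e.
by apply/diff_locallyP; rewrite d; split=> //; exact: cst_continuous.
Qed.

(** Differentiability at a point is local: f and g differ by a map that vanishes
    near the point. *)
Lemma differentiable_near (W : normedModType R) (f g : V -> W) x :
  (\forall y \near x, f y = g y) -> differentiable f x -> differentiable g x.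
Proof.
move=> fg df; have -> : g = f + (g - f) by rewrite addrC subrK.
apply: differentiableD => //; apply: differentiable_near0.
by apply: filterS fg => y e; rewrite !fctE e subrr.
Qed.

Lemma open_near_eq (W : Type) (U : set V) (f g : V -> W) x :
  open U -> U x -> (forall y, U y -> f y = g y) -> \forall y \near x, f y = g y.
Proof. by move=> oU Ux fg; apply: filterS fg _; exact: open_nbhs_nbhs. Qed.

(** The class C^k on an open set depends only on the values there, although the
    derivatives in its definition are those of globally defined maps.  The
    lemmas that follow use it to replace the derivative of an expression by the
    formula for it, which is valid on the open set only. *)
Lemma Ck_on_eq (W : normedModType R) k (U : set V) (f g : V -> W) :
  open U -> (forall x, U x -> f x = g x) -> Ck_on k U f -> Ck_on k U g.
Proof.
move=> oU; elim: k f g => [|k IH] f g fg /=.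
  move=> fc x Ux; have e := open_near_eq oU Ux fg.
  rewrite /prop_for /continuous_at -(fg x Ux); apply: cvg_trans (fc x Ux).
  by apply: near_eq_cvg; apply: filterS e.
move=> [df Df]; split=> [x Ux|v].
  exact: differentiable_near (open_near_eq oU Ux fg) (df x Ux).
by apply: IH (Df v) => x Ux; apply: near_eq_derive; exact: open_near_eq fg.
Qed.

Lemma Ck_onW (W : normedModType R) k (U : set V) (f : V -> W) :
  Ck_on k.+1 U f -> Ck_on k U f.
Proof.
elim: k f => [|k IH] f [df Df].
  by move=> x Ux; apply: differentiable_continuous; exact: df.
by split=> // v; exact: IH.
Qed.

Lemma Ck_on_cst (W : normedModType R) k (U : set V) (c : W) :
  Ck_on k U (cst c : V -> W).
Proof.
elim: k c => [|k IH] c; first by move=> x _; exact: cst_continuous.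
split=> [x _|v]; first exact: differentiable_cst.
have -> : 'D_v (cst c : V -> W) = cst 0; last exact: IH.
by apply/funext => x; rewrite derive_cst.
Qed.

Lemma Ck_onD (W : normedModType R) k (U : set V) (f g : V -> W) : open U ->
  Ck_on k U f -> Ck_on k U g -> Ck_on k U (fun x => f x + g x).
Proof.
move=> oU; elim: k f g => [|k IH] f g.
  by move=> cf cg x Ux; apply: cvgD; [exact: cf|exact: cg].
move=> [df Df] [dg Dg]; split=> [x Ux|v].
  by apply: differentiableD; [exact: df|exact: dg].
apply: (Ck_on_eq oU _ (IH _ _ (Df v) (Dg v))) => x Ux.
by rewrite [RHS]deriveD //; apply: diff_derivable; [exact: df|exact: dg].
Qed.

Lemma Ck_on_sum (W : normedModType R) (I : Type) (r : seq I) (P : pred I)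
    k (U : set V) (f : I -> V -> W) : open U ->
  (forall i, Ck_on k U (f i)) -> Ck_on k U (fun x => \sum_(i <- r | P i) f i x).
Proof.
move=> oU sf; elim: r => [|i r IH].
  by apply: (Ck_on_eq oU _ (Ck_on_cst k U 0)) => x _; rewrite big_nil.
have [Pi|nPi] := boolP (P i).
  by apply: (Ck_on_eq oU _ (Ck_onD oU (sf i) IH)) => x _; rewrite big_cons Pi.
by apply: (Ck_on_eq oU _ IH) => x _; rewrite big_cons (negbTE nPi).
Qed.

Lemma Ck_onM k (U : set V) (f g : V -> R) : open U ->
  Ck_on k U f -> Ck_on k U g -> Ck_on k U (fun x => f x * g x).
Proof.
move=> oU; elim: k f g => [|k IH] f g.
  by move=> cf cg x Ux; apply: cvgM; [exact: cf|exact: cg].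
move=> Cf Cg; have [df Df] := Cf; have [dg Dg] := Cg.
split=> [x Ux|v].
  by apply: differentiableM; [exact: df|exact: dg].
have := Ck_onD oU (IH _ _ (Ck_onW Cf) (Dg v)) (IH _ _ (Ck_onW Cg) (Df v)).
apply: (Ck_on_eq oU) => x Ux.
by rewrite [RHS]deriveM //; apply: diff_derivable; [exact: df|exact: dg].
Qed.

Lemma Ck_on_prod (I : Type) (r : seq I) (P : pred I)
    k (U : set V) (f : I -> V -> R) : open U ->
  (forall i, Ck_on k U (f i)) -> Ck_on k U (fun x => \prod_(i <- r | P i) f i x).
Proof.
move=> oU sf; elim: r => [|i r IH].
  by apply: (Ck_on_eq oU _ (Ck_on_cst k U (1 : R^o))) => x _; rewrite big_nil.
have [Pi|nPi] := boolP (P i).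
  by apply: (Ck_on_eq oU _ (Ck_onM oU (sf i) IH)) => x _; rewrite big_cons Pi.
by apply: (Ck_on_eq oU _ IH) => x _; rewrite big_cons (negbTE nPi).
Qed.

Lemma Ck_onV k (U : set V) (f : V -> R) : open U ->
  (forall x, U x -> f x != 0) ->
  Ck_on k U f -> Ck_on k U (fun x => (f x)^-1).
Proof.
move=> oU f0; elim: k => [|k IH].
  by move=> cf x Ux; apply: cvgV; [exact: f0|exact: cf].
move=> Cf; have [df Df] := Cf; split=> [x Ux|v].
  by apply: differentiableV; [exact: df|exact: f0].
have Cv := IH (Ck_onW Cf).
have := Ck_onM oU (Ck_on_cst k U (-1 : R^o)) (Ck_onM oU (Ck_onM oU Cv Cv) (Df v)).
apply: (Ck_on_eq oU) => x Ux.
rewrite [RHS]deriveV; [|exact: f0|by apply: diff_derivable; exact: df].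
by rewrite mulN1r scaleNr /GRing.scale /= expr2 invfM.
Qed.

Lemma differentiable_entries m n (f : V -> 'M[R]_(m, n)) x :
  (forall i j, differentiable (fun y => f y i j) x) -> differentiable f x.
Proof.
move=> df.
have -> : f = \sum_i \sum_j (fun y => f y i j *: delta_mx i j).
  apply/funext => y; rewrite fct_sumE.
  rewrite [LHS]matrix_sum_delta; apply: eq_bigr => i _.
  by rewrite fct_sumE.
apply: differentiable_sum => i; apply: differentiable_sum => j.
exact: differentiableZl.
Qed.

Lemma derive_entry m n (f : V -> 'M[R]_(m, n)) x v i j :
  derivable f x v -> 'D_v (fun y => f y i j) x = 'D_v f x i j.
Proof. by move=> df; rewrite derive_mx // mxE. Qed.

Lemma differentiable_entry m n (f : V -> 'M[R]_(m, n)) x i j :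
  differentiable f x -> differentiable (fun y => f y i j) x.
Proof.
by move=> df; exact: (differentiable_comp df (differentiable_coord _ i j)).
Qed.

Lemma Ck_on_entryP m n k (U : set V) (f : V -> 'M[R]_(m, n)) : open U ->
  Ck_on k U f <-> forall i j, Ck_on k U (fun y => f y i j).
Proof.
move=> oU; split.
  move=> + i j; elim: k f => [|k IH] f.
    move=> cf x Ux.
    have c := differentiable_continuous (differentiable_coord (f x) i j).
    exact: (@continuous_comp V 'M[R]_(m, n) R f (fun M => M i j) x (cf x Ux) c).
  move=> [df Df]; split=> [x Ux|v].
    exact: differentiable_entry (df x Ux).
  apply: (Ck_on_eq oU _ (IH _ (Df v))) => x Ux.
  by rewrite derive_entry //; apply: diff_derivable; exact: df.
elim: k f => [|k IH] f Cf.
  have e x : U x -> \sum_i \sum_j f x i j *: delta_mx i j = f x.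
    by rewrite -matrix_sum_delta.
  apply: (Ck_on_eq oU e); apply: (@Ck_on_sum _ _ _ _ 0) => // i.
  apply: (@Ck_on_sum _ _ _ _ 0) => // j x Ux.
  by apply: continuousZr_tmp; exact: Cf.
have df x : U x -> differentiable f x.
  by move=> Ux; apply: differentiable_entries => i j; have [+ _] := Cf i j; exact.
split=> // v; apply: IH => i j; have [_ /(_ v)] := Cf i j.
apply: (Ck_on_eq oU) => x Ux.
by rewrite derive_entry //; apply: diff_derivable; exact: df.
Qed.

End FrechetCalculus.

(** * Smooth maps *)

Section SmoothMaps.
Variables (R : realType) (V : normedModType R).
Implicit Types U : set V.

Lemma smooth_on_eq (W : normedModType R) U (f g : V -> W) :
  open U -> (forall x, U x -> f x = g x) -> smooth_on U f -> smooth_on U g.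
Proof. by move=> oU fg sf k; exact: Ck_on_eq (sf k). Qed.

Lemma smooth_on_sub (W : normedModType R) U U' (f : V -> W) :
  U' `<=` U -> smooth_on U f -> smooth_on U' f.
Proof.
move=> sU sf k; move: (sf k); elim: k f {sf} => [|k IH] f.
  by move=> Cf x /sU; exact: Cf.
by move=> [df Df]; split=> [x /sU|v]; [exact: df|exact: IH (Df v)].
Qed.

Lemma smooth_on_cst (W : normedModType R) U (c : W) :
  smooth_on U (fun _ : V => c).
Proof. by move=> k; exact: Ck_on_cst. Qed.

Lemma smooth_onM U (f g : V -> R) : open U ->
  smooth_on U f -> smooth_on U g -> smooth_on U (fun x => f x * g x).
Proof. by move=> oU sf sg k; exact: Ck_onM. Qed.

Lemma smooth_on_sum (W : normedModType R) (I : Type) (r : seq I) (P : pred I)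
    U (f : I -> V -> W) : open U -> (forall i, smooth_on U (f i)) ->
  smooth_on U (fun x => \sum_(i <- r | P i) f i x).
Proof. by move=> oU sf k; apply: Ck_on_sum => // i; exact: sf. Qed.

Lemma smooth_on_prod (I : Type) (r : seq I) (P : pred I)
    U (f : I -> V -> R) : open U -> (forall i, smooth_on U (f i)) ->
  smooth_on U (fun x => \prod_(i <- r | P i) f i x).
Proof. by move=> oU sf k; apply: Ck_on_prod => // i; exact: sf. Qed.

Lemma smooth_on_entryP m n U (f : V -> 'M[R]_(m, n)) : open U ->
  smooth_on U f <-> forall i j, smooth_on U (fun y => f y i j).
Proof.
move=> oU; split=> [sf i j k|sf k]; first exact: (Ck_on_entryP _ _ oU).1.
by apply/(Ck_on_entryP _ _ oU) => i j; exact: sf.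
Qed.

Lemma smooth_on_differentiable (W : normedModType R) U (f : V -> W) x :
  smooth_on U f -> U x -> differentiable f x.
Proof. by move=> sf; have [+ _] := sf 1%N; exact. Qed.

Lemma smooth_on_derivable (W : normedModType R) U (f : V -> W) x v :
  smooth_on U f -> U x -> derivable f x v.
Proof.
by move=> sf Ux; apply: diff_derivable; exact: smooth_on_differentiable Ux.
Qed.

Lemma smooth_on_derive (W : normedModType R) U (f : V -> W) v :
  smooth_on U f -> smooth_on U ('D_v f).
Proof. by move=> sf k; have [_] := sf k.+1; exact. Qed.

Lemma smooth_onD (W : normedModType R) U (f g : V -> W) : open U ->
  smooth_on U f -> smooth_on U g -> smooth_on U (fun x => f x + g x).
Proof. by move=> oU sf sg k; exact: Ck_onD. Qed.

Lemma smooth_on_mulmx m n p U (A : V -> 'M[R]_(m, n)) (B : V -> 'M[R]_(n, p)) :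
  open U -> smooth_on U A -> smooth_on U B ->
  smooth_on U (fun x => A x *m B x).
Proof.
move=> oU /(smooth_on_entryP _ oU) sA /(smooth_on_entryP _ oU) sB.
apply/(smooth_on_entryP _ oU) => i j.
have : smooth_on U (fun x => \sum_k A x i k * B x k j).
  by apply: smooth_on_sum => // k; exact: smooth_onM.
by apply: smooth_on_eq => // x _; rewrite mxE.
Qed.

Lemma smooth_onZ m n U (a : V -> R) (A : V -> 'M[R]_(m, n)) :
  open U -> smooth_on U a -> smooth_on U A -> smooth_on U (fun x => a x *: A x).
Proof.
move=> oU sa /(smooth_on_entryP _ oU) sA.
apply/(smooth_on_entryP _ oU) => i j.
by apply: (smooth_on_eq oU _ (smooth_onM oU sa (sA i j))) => x _; rewrite mxE.
Qed.

Lemma smooth_onB m n U (A B : V -> 'M[R]_(m, n)) : open U ->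
  smooth_on U A -> smooth_on U B -> smooth_on U (fun x => A x - B x).
Proof.
move=> oU sA sB.
have := smooth_onD oU sA (smooth_onZ oU (smooth_on_cst U (-1 : R^o)) sB).
by apply: smooth_on_eq => // x _; rewrite scaleN1r.
Qed.

Lemma smooth_on_trmx m n U (A : V -> 'M[R]_(m, n)) : open U ->
  smooth_on U A -> smooth_on U (fun x => (A x)^T).
Proof.
move=> oU /(smooth_on_entryP _ oU) sA; apply/(smooth_on_entryP _ oU) => i j.
by apply: (smooth_on_eq oU _ (sA j i)) => x _; rewrite mxE.
Qed.

Lemma smooth_on_det n U (A : V -> 'M[R]_n) : open U ->
  smooth_on U A -> smooth_on U (fun x => \det (A x)).
Proof.
move=> oU /(smooth_on_entryP _ oU) sA.
apply: smooth_on_sum => // s; apply: smooth_onM => //.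
  exact: (smooth_on_cst U (_ : R^o)).
exact: smooth_on_prod.
Qed.

(** By Cramer's rule the inverse is a rational function of the entries. *)
Lemma smooth_on_invmx n U (A : V -> 'M[R]_n) : open U ->
  (forall x, U x -> A x \in unitmx) ->
  smooth_on U A -> smooth_on U (fun x => invmx (A x)).
Proof.
move=> oU uA sA.
have sdet : smooth_on U (fun x => (\det (A x))^-1).
  move=> k; apply: Ck_onV => //; last exact: smooth_on_det.
  by move=> x /uA; rewrite unitmxE unitfE.
have sadj : smooth_on U (fun x => \adj (A x)).
  apply/(smooth_on_entryP _ oU) => i j.
  have : smooth_on U (fun x => cofactor (A x) j i).
    apply: smooth_onM => //; first exact: (smooth_on_cst U (_ : R^o)).
    apply: smooth_on_det => //; apply/(smooth_on_entryP _ oU) => a b.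
    have := (smooth_on_entryP _ oU).1 sA (lift j a) (lift i b).
    by apply: smooth_on_eq => // x _; rewrite !mxE.
  by apply: smooth_on_eq => // x _; rewrite mxE.
apply: (smooth_on_eq oU _ (smooth_onZ oU sdet sadj)) => x Ux.
by rewrite /invmx uA.
Qed.

Lemma derive_mulmx m n p (A : V -> 'M[R]_(m, n)) (B : V -> 'M[R]_(n, p)) x v :
  derivable A x v -> derivable B x v ->
  'D_v (fun y => A y *m B y) x = 'D_v A x *m B x + A x *m 'D_v B x.
Proof.
move=> dA dB; have eA := (derivable_mxP _ _ _).1 dA.
have eB := (derivable_mxP _ _ _).1 dB.
have e i j : is_derive x v (fun y => (A y *m B y) i j)
    (\sum_k (A x i k * 'D_v (fun y => B y k j) x
             + B x k j * 'D_v (fun y => A y i k) x)).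
  have -> : (fun y => (A y *m B y) i j) =
      \sum_k ((fun y => A y i k) * (fun y => B y k j)).
    by apply/funext => y; rewrite mxE fct_sumE.
  apply: is_derive_sum => k; apply: is_deriveM; exact: derivableP.
rewrite derive_mx; last first.
  by apply/derivable_mxP => i j; have [] := e i j.
apply/matrixP => i j; rewrite !mxE (@derive_val _ _ _ _ _ _ _ (e i j)).
rewrite -big_split; apply: eq_bigr => k _ /=.
by rewrite !derive_entry // addrC [B x k j * _]mulrC.
Qed.

Lemma derive_trmx m n (A : V -> 'M[R]_(m, n)) x v : derivable A x v ->
  'D_v (fun y => (A y)^T) x = ('D_v A x)^T.
Proof.
move=> dA; have eA := (derivable_mxP _ _ _).1 dA.
have e i j : (fun y => (A y)^T i j) = (fun y => A y j i).
  by apply/funext => y; rewrite mxE.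
rewrite derive_mx; last by apply/derivable_mxP => i j; rewrite e.
by apply/matrixP => i j; rewrite !mxE e derive_entry.
Qed.

Lemma derive_mulmxl m n p (A : 'M[R]_(m, n))
    (B : V -> 'M[R]_(n, p)) x v : derivable B x v ->
  'D_v (fun y => A *m B y) x = A *m 'D_v B x.
Proof.
move=> dB; rewrite derive_mulmx //.
by rewrite (derive_cst A) mul0mx add0r.
Qed.

Lemma derive_mulmxr m n p (A : V -> 'M[R]_(m, n))
    (B : 'M[R]_(n, p)) x v : derivable A x v ->
  'D_v (fun y => A y *m B) x = 'D_v A x *m B.
Proof.
move=> dA; rewrite derive_mulmx //.
by rewrite (derive_cst B) mulmx0 addr0.
Qed.

Lemma derivable_mulmx m n p (A : V -> 'M[R]_(m, n))
    (B : V -> 'M[R]_(n, p)) x v : derivable A x v -> derivable B x v ->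
  derivable (fun y => A y *m B y) x v.
Proof.
move=> /derivable_mxP dA /derivable_mxP dB; apply/derivable_mxP => i j.
have -> : (fun y => (A y *m B y) i j) =
    \sum_k ((fun y => A y i k) * (fun y => B y k j)).
  by apply/funext => y; rewrite mxE fct_sumE.
by apply: derivable_sum => k; exact: derivableM.
Qed.

End SmoothMaps.

Section CoordinateSpace.
Variables (R : realType) (n : nat).

Lemma derive_frame (W : normedModType R) (f : 'rV[R]_n -> W) x v :
  differentiable f x -> 'D_v f x = \sum_i v 0 i *: 'D_(frame R i) f x.
Proof.
move=> df; rewrite [in LHS](row_sum_delta v) deriveE // linear_sum.
by apply: eq_bigr => i _; rewrite linearZ /= deriveE.
Qed.

Lemma derive_comp_rV (V W : normedModType R) (F : V -> 'rV[R]_n)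
    (h : 'rV[R]_n -> W) x v : differentiable F x -> differentiable h (F x) ->
  'D_v (fun y => h (F y)) x = 'D_('D_v F x) h (F x).
Proof.
move=> dF dh; rewrite (deriveE _ dh) (deriveE _ dF).
rewrite (deriveE _ (differentiable_comp dF dh)).
by have -> := diff_comp dF dh.
Qed.

(** By induction on the class: [D_v (h o F)] is the sum of the products of the
    coordinates of [D_v F] with the [(D_i h) o F], to which the induction
    hypothesis applies. *)
Lemma smooth_on_comp (V : normedModType R) (U : set V) (Y : set 'rV[R]_n)
    (F : V -> 'rV[R]_n) (h : 'rV[R]_n -> R) : open U ->
  (forall x, U x -> Y (F x)) -> smooth_on U F -> smooth_on Y h ->
  smooth_on U (fun x => h (F x)).
Proof.
move=> oU FY sF sh k; elim: k h sh => [|k IH] h sh.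
  move=> x Ux.
  have cF := differentiable_continuous (smooth_on_differentiable sF Ux).
  have ch := differentiable_continuous (smooth_on_differentiable sh (FY x Ux)).
  exact: (continuous_comp cF ch).
split=> [x Ux|v].
  apply: differentiable_comp; first exact: smooth_on_differentiable Ux.
  exact: smooth_on_differentiable (FY x Ux).
have sE i : smooth_on Y ('D_(frame R i) h) by exact: smooth_on_derive.
have sD i : smooth_on U (fun x => 'D_v F x 0 i).
  by apply: (smooth_on_entryP _ oU).1; exact: smooth_on_derive.
have := Ck_on_sum (index_enum _) xpredT oU (fun i => Ck_onM oU (sD i k) (IH _ (sE i))).
apply: (Ck_on_eq oU) => x Ux.
have dF := smooth_on_differentiable sF Ux.
have dh := smooth_on_differentiable sh (FY x Ux).
by rewrite [RHS](derive_comp_rV v dF dh) [RHS]derive_frame.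
Qed.

Lemma smooth_on_comp_mx (V : normedModType R) (U : set V) (Y : set 'rV[R]_n)
    (F : V -> 'rV[R]_n) p q (h : 'rV[R]_n -> 'M[R]_(p, q)) :
  open U -> open Y ->
  (forall x, U x -> Y (F x)) -> smooth_on U F -> smooth_on Y h ->
  smooth_on U (fun x => h (F x)).
Proof.
move=> oU oY FY sF /(smooth_on_entryP _ oY) sh.
by apply/(smooth_on_entryP _ oU) => i j; exact: smooth_on_comp (sh i j).
Qed.

End CoordinateSpace.

(** * Symmetry of second derivatives *)

Section Schwarz.
Variables (R : realType) (V : normedModType R).

Lemma is_derive_line (f : V -> R) p v (t : R) : derivable f (p + t *: v) v ->
  is_derive t 1 (fun t => f (p + t *: v)) ('D_v f (p + t *: v)).
Proof.
have e : (fun h : R => h^-1 *: (f (p + (h *: 1 + t) *: v) - f (p + t *: v))) =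
         (fun h : R => h^-1 *: (f (h *: v + (p + t *: v)) - f (p + t *: v))).
  apply/funext => h; congr (_ *: (f _ - _)).
  by rewrite scalerDl addrCA /GRing.scale /= mulr1.
by move=> df; apply: DeriveDef; rewrite /derivable /derive /= ?e //.
Qed.

(** The mean value theorem, applied first along v to
    [t |-> f (x + t v + s w) - f (x + t v)] and then along w to the derivative. *)
Lemma second_difference (U : set V) (f : V -> R) x v w (s : R) : 0 < s ->
  Ck_on 2 U f ->
  (forall a b : R, 0 <= a <= s -> 0 <= b <= s -> U (x + a *: v + b *: w)) ->
  exists a b : R, [/\ 0 <= a <= s, 0 <= b <= s &
    f (x + s *: v + s *: w) - f (x + s *: w) - (f (x + s *: v) - f x)
    = s ^+ 2 * 'D_w ('D_v f) (x + a *: v + b *: w)].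
Proof.
move=> s0 [df /(_ v)[ddf _]] Us.
have Us0 a : 0 <= a <= s -> U (x + a *: v).
  by move=> ab; have := Us a 0 ab; rewrite scale0r addr0 lexx ltW //; exact.
have Us1 a : 0 <= a <= s -> U (x + s *: w + a *: v).
  by move=> ab; rewrite addrAC; apply: Us => //; rewrite ltW /=.
pose phi t := f (x + s *: w + t *: v) - f (x + t *: v).
pose dphi t := 'D_v f (x + s *: w + t *: v) - 'D_v f (x + t *: v).
have dphiP t : 0 <= t <= s -> is_derive t 1 phi (dphi t).
  move=> ts; apply: is_deriveB; apply: is_derive_line; apply: diff_derivable;
    apply: df; first [exact: Us1|exact: Us0].
have [||a] := @MVT _ phi dphi 0 s s0.
- by move=> t; rewrite in_itv /= => /andP[t0 ts]; apply: dphiP; rewrite !ltW.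
- apply: derivable_within_continuous => t; rewrite in_itv /= => ts.
  by have [] := dphiP t ts.
rewrite in_itv /= => /andP[a0 as_] phiE.
have ab : 0 <= a <= s by rewrite !ltW.
pose psi t := 'D_v f (x + a *: v + t *: w).
pose dpsi t := 'D_w ('D_v f) (x + a *: v + t *: w).
have dpsiP t : 0 <= t <= s -> is_derive t 1 psi (dpsi t).
  by move=> ts; apply: is_derive_line; apply: diff_derivable; apply: ddf; exact: Us.
have [||b] := @MVT _ psi dpsi 0 s s0.
- by move=> t; rewrite in_itv /= => /andP[t0 ts]; apply: dpsiP; rewrite !ltW.
- apply: derivable_within_continuous => t; rewrite in_itv /= => ts.
  by have [] := dpsiP t ts.
rewrite in_itv /= => /andP[b0 bs] psiE.
exists a, b; split=> //; first by rewrite !ltW.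
move: phiE psiE; rewrite /phi /dphi /psi /dpsi !scale0r !addr0 !subr0.
rewrite [x + s *: w + a *: v]addrAC [x + s *: w + s *: v]addrAC => e1 e2.
rewrite expr2 -mulrA [s * 'D_w _ _]mulrC -e2 mulrC -e1.
ring.
Qed.

(** Both iterated derivatives are limits of the same second difference quotient. *)
Lemma derive_commute (U : set V) (f : V -> R) x v w : open U -> U x ->
  Ck_on 2 U f -> 'D_v ('D_w f) x = 'D_w ('D_v f) x.
Proof.
move=> oU Ux Cf; apply/eqP; rewrite -subr_eq0 -normr_le0; apply/ler_addgt0Pr.
move=> e e0; rewrite add0r.
(* Both second derivatives are close to their values at x on a ball; s is such that
   the parallelogram with sides s v and s w fits in it. *)
have cont u1 u2 : {for x, continuous ('D_u1 ('D_u2 f))}.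
  by case: Cf => _ /(_ u2)[_ /(_ u1)]; exact.
have close (p q t : R) : `|p - t| <= e / 2 -> `|q - t| <= e / 2 -> `|p - q| <= e.
  move=> pt qt; rewrite [e]splitr; apply: le_trans (ler_distD t _ _) _.
  by rewrite lerD // distrC.
have e2 : 0 < e / 2 by rewrite divr_gt0.
have near_le u1 u2 :
    \forall y \near x, `|'D_u1 ('D_u2 f) x - 'D_u1 ('D_u2 f) y| <= e / 2.
  by move: (cont u1 u2) => /cvgrPdist_le; apply.
have /nbhs_ballP[r /= r0 rP] : \forall y \near x, [/\ U y,
    `|'D_v ('D_w f) x - 'D_v ('D_w f) y| <= e / 2 &
    `|'D_w ('D_v f) x - 'D_w ('D_v f) y| <= e / 2].
  have nU : nbhs x U by exact: open_nbhs_nbhs.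
  by apply: filterS3 nU (near_le v w) (near_le w v) => y uy y1 y2; split.
pose k := `|v| + `|w| + 1.
have k0 : 0 < k by rewrite ltr_wpDl // addr_ge0.
pose s := r / (2 * k).
have s0 : 0 < s by rewrite divr_gt0 // mulr_gt0.
have inB a b : 0 <= a <= s -> 0 <= b <= s -> ball x r (x + a *: v + b *: w).
  move=> /andP[a0 as_] /andP[b0 bs].
  rewrite -ball_normE /= -addrA opprD addrA subrr sub0r normrN.
  apply: (le_lt_trans (ler_normD _ _)); rewrite !normrZ !ger0_norm //.
  apply: (@le_lt_trans _ _ (s * k)).
    rewrite /k !mulrDr mulr1.
    have := ler_wpM2r (normr_ge0 v) as_; have := ler_wpM2r (normr_ge0 w) bs.
    lra.
  by rewrite /s invfM mulrA divfK ?gt_eqF // ltr_pdivrMr // mulr_natr mulr2n ltrDl.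
have inU a b sa sb := let: And3 u _ _ := rP _ (inB a b sa sb) in u.
have [a [b [sa sb E1]]] := second_difference s0 Cf inU.
have [|c [d [sc sd E2]]] := @second_difference U f x w v s s0 Cf.
  by move=> a' b' sa' sb'; rewrite addrAC; exact: inU.
have s20 : s ^+ 2 != 0 by rewrite expf_neq0 // gt_eqF.
have eD : 'D_w ('D_v f) (x + a *: v + b *: w) = 'D_v ('D_w f) (x + c *: w + d *: v).
  have swap (p q t u : R) : p - q - (t - u) = p - t - (q - u) by ring.
  apply: (mulfI s20); apply: (etrans (esym E1)); apply: etrans E2.
  by rewrite [x + s *: w + s *: v]addrAC swap.
have [_ _ l1] := rP _ (inB a b sa sb).
have [_ l2 _] := rP _ (inB d c sd sc).
rewrite addrAC -eD in l2; exact: close l2 l1.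
Qed.

Lemma derive_commute_mx (U : set V) m n (f : V -> 'M[R]_(m, n)) x v w :
  open U -> U x -> smooth_on U f -> 'D_v ('D_w f) x = 'D_w ('D_v f) x.
Proof.
move=> oU Ux sf; apply/matrixP => i j.
have sD u := smooth_on_derive u sf.
have D u : \forall y \near x, 'D_u (fun y => f y i j) y = 'D_u f y i j.
  apply: (open_near_eq oU Ux) => y Uy.
  by rewrite derive_entry //; exact: smooth_on_derivable Uy.
rewrite -[LHS]derive_entry; last exact: smooth_on_derivable Ux.
rewrite -[RHS]derive_entry; last exact: smooth_on_derivable Ux.
rewrite -(near_eq_derive v (D w)) -(near_eq_derive w (D v)).
by apply: (derive_commute _ _ oU Ux); exact: (smooth_on_entryP _ oU).1.
Qed.

End Schwarz.

(** * Bilinear and trilinear forms *)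

Section MatrixLemmas.
Variables (R : realType).

Lemma eq_row_mulmx m n (A B : 'M[R]_(m, n)) :
  (forall w : 'rV_m, w *m A = w *m B) -> A = B.
Proof. by move=> AB; apply/row_matrixP => i; rewrite !rowE. Qed.

Lemma mx11_trmx (A : 'M[R]_1) : A^T = A.
Proof. by apply/matrixP => i j; rewrite mxE !ord1. Qed.

Lemma bilinear_trmx m n (B : 'M[R]_(m, n)) (v : 'rV_m) (w : 'rV_n) :
  (v *m B *m w^T) 0 0 = (w *m B^T *m v^T) 0 0.
Proof. by rewrite -[v *m _ *m _]mx11_trmx trmx_mul trmx_mul trmxK mulmxA. Qed.

Lemma eq_bilinear_mx m (A B : 'M[R]_m) :
  (forall v w : 'rV_m, (v *m A *m w^T) 0 0 = (v *m B *m w^T) 0 0) -> A = B.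
Proof.
move=> AB; apply/matrixP => i j.
by have := AB (delta_mx 0 i) (delta_mx 0 j); rewrite !trmx_delta -!rowE -!colE !mxE.
Qed.

(** A trilinear form symmetric in its first two arguments and skew in its last
    two vanishes: the uniqueness of the Levi-Civita connection. *)
Lemma sym_skew_eq0 (A : Type) (e : A -> A -> A -> R) :
  (forall a b c, e a b c = e b a c) -> (forall a b c, e a b c = - e a c b) ->
  forall a b c, e a b c = 0.
Proof.
move=> S K a b c.
have : e a b c = - e a b c.
  by rewrite {1}K S K S K S !opprK.
lra.
Qed.

End MatrixLemmas.

(** * The Levi-Civita connection in matrix form *)

Section Connection.
Variables (R : realType) (m : nat) (g : 'rV[R]_m -> 'M[R]_m).
Implicit Types (u v w x y : 'rV[R]_m).

(** The matrix of [(w, z) |-> <nabla_u w, z>] on constant fields, by Koszul's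
    formula. *)
Definition koszul_mx u x : 'M[R]_m := \matrix_(i, l)
  (2^-1 * ('D_u g x i l + (u *m 'D_(frame R i) g x) 0 l
           - (u *m 'D_(frame R l) g x) 0 i)).

(** The matrix of [w |-> nabla_u w] on constant fields.  It is locked so that
    associativity does not rewrite inside it. *)
Definition connection_mx u x : 'M[R]_m := locked (koszul_mx u x *m invmx (g x)).

Lemma connection_mxE u x : connection_mx u x = koszul_mx u x *m invmx (g x).
Proof. by rewrite /connection_mx -lock. Qed.

Lemma derive_inner x u v w : derivable g x u ->
  'D_u (fun y => inner g y v w) x = (v *m 'D_u g x *m w^T) 0 0.
Proof.
move=> dg; have dvg := derivable_mulmx (derivable_cst v x u) dg.
rewrite /inner derive_entry.
  by rewrite derive_mulmxr // derive_mulmxl.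
exact: (derivable_mulmx dvg (derivable_cst _ _ _)).
Qed.

Lemma koszul_mx_row x u w l : differentiable g x ->
  (w *m koszul_mx u x) 0 l =
  2^-1 * ((w *m 'D_u g x) 0 l + (u *m 'D_w g x) 0 l
          - (u *m 'D_(frame R l) g x *m w^T) 0 0).
Proof.
move=> dg.
have e1 : (w *m 'D_u g x) 0 l = \sum_i w 0 i * 'D_u g x i l by rewrite mxE.
have e2 : (u *m 'D_w g x) 0 l = \sum_i w 0 i * (u *m 'D_(frame R i) g x) 0 l.
  rewrite (derive_frame w dg) mulmx_sumr summxE; apply: eq_bigr => i _.
  by rewrite -scalemxAr mxE.
have e3 : (u *m 'D_(frame R l) g x *m w^T) 0 0 =
    \sum_i (u *m 'D_(frame R l) g x) 0 i * w 0 i.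
  by rewrite mxE; apply: eq_bigr => i _; rewrite [w^T _ _]mxE.
have e0 : (w *m koszul_mx u x) 0 l = \sum_i w 0 i * koszul_mx u x i l by rewrite mxE.
have half (p q r p' q' r' : R) : p = p' -> q = q' -> r = r' ->
    2^-1 * (p' + q' - r') = 2^-1 * (p + q - r) by move=> -> -> ->.
apply: (etrans e0); apply: etrans (half _ _ _ _ _ _ e1 e2 e3).
rewrite -big_split -sumrB mulr_sumr.
by apply: eq_bigr => i _; rewrite /= [koszul_mx _ _ _ _]mxE; ring.
Qed.

Lemma koszul_mxE x u w z : differentiable g x ->
  (w *m koszul_mx u x *m z^T) 0 0 =
  2^-1 * ((w *m 'D_u g x *m z^T) 0 0 + (u *m 'D_w g x *m z^T) 0 0
          - (u *m 'D_z g x *m w^T) 0 0).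
Proof.
move=> dg.
have e (v : 'rV[R]_m) : (v *m z^T) 0 0 = \sum_l v 0 l * z 0 l.
  by rewrite mxE; apply: eq_bigr => i _; rewrite [z^T _ _]mxE.
have e3 : (u *m 'D_z g x *m w^T) 0 0 =
    \sum_l z 0 l * (u *m 'D_(frame R l) g x *m w^T) 0 0.
  rewrite (derive_frame z dg) mulmx_sumr mulmx_suml summxE; apply: eq_bigr => i _.
  by rewrite -scalemxAr -scalemxAl mxE.
have half (p q r p' q' r' : R) : p = p' -> q = q' -> r = r' ->
    2^-1 * (p' + q' - r') = 2^-1 * (p + q - r) by move=> -> -> ->.
apply: (etrans (e _)); apply: etrans (half _ _ _ _ _ _ (e _) (e _) e3).
rewrite -big_split -sumrB mulr_sumr.
have alg (p q r t : R) :
    2^-1 * (p + q - r) * t = 2^-1 * (p * t + q * t - t * r) by ring.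
apply: eq_bigr => l _; apply: etrans (alg _ _ _ _).
by congr (_ * _); exact: koszul_mx_row.
Qed.

Lemma christoffelE x u w : differentiable g x ->
  christoffel g x u w = w *m connection_mx u x.
Proof.
move=> dg; rewrite /christoffel connection_mxE mulmxA scalemxAl.
congr (_ *m _); apply/rowP => l.
have dgv v : derivable g x v by exact: diff_derivable.
have ewf v (A : 'M[R]_m) : (v *m A *m (frame R l)^T) 0 0 = (v *m A) 0 l.
  by rewrite /frame trmx_delta -colE mxE.
have half (p q r p' q' r' : R) : p = p' -> q = q' -> r = r' ->
    2^-1 * (p + q - r) = 2^-1 * (p' + q' - r') by move=> -> -> ->.
rewrite (koszul_mx_row u w l dg) [LHS]mxE [X in _ * X]mxE.
apply: half; last exact: (derive_inner u w (dgv (frame R l))).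
  exact: etrans (derive_inner w (frame R l) (dgv u)) (ewf w _).
exact: etrans (derive_inner u (frame R l) (dgv w)) (ewf u _).
Qed.

Lemma covE (X : 'rV[R]_m -> 'rV[R]_m) x v : differentiable g x ->
  cov g X v x = 'D_v X x + X x *m connection_mx v x.
Proof. by move=> dg; rewrite /cov christoffelE. Qed.

Section AtPoint.
Variable x : 'rV[R]_m.
Hypotheses (dg : differentiable g x) (gsym : \forall y \near x, (g y)^T = g y).
Hypothesis gunit : g x \in unitmx.

Lemma derive_sym u : ('D_u g x)^T = 'D_u g x.
Proof.
rewrite -derive_trmx; last exact: diff_derivable.
exact: near_eq_derive.
Qed.

Lemma derive_symE u v w : (v *m 'D_u g x *m w^T) 0 0 = (w *m 'D_u g x *m v^T) 0 0.
Proof. by rewrite bilinear_trmx derive_sym. Qed.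

(** No torsion: for a symmetric g, Koszul's formula is symmetric in its first two
    arguments. *)
Lemma christoffelC u w : christoffel g x u w = christoffel g x w u.
Proof.
have dgv v : derivable g x v by exact: diff_derivable.
rewrite /christoffel; apply: congr1; apply: (congr1 (mulmx^~ _)).
apply/rowP => l; rewrite [LHS]mxE [RHS]mxE.
rewrite [X in X - _]addrC; congr (_ - _).
by rewrite (derive_inner u w (dgv _)) (derive_inner w u (dgv _)) derive_symE.
Qed.

Lemma connection_mxC u w : u *m connection_mx w x = w *m connection_mx u x.
Proof. by rewrite -(christoffelE w u dg) -(christoffelE u w dg) christoffelC. Qed.

Lemma connection_mx_frame u :
  connection_mx u x = \sum_i u 0 i *: connection_mx (frame R i) x.
Proof.
apply: eq_row_mulmx => w; rewrite mulmx_sumr connection_mxC.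
rewrite {1}(row_sum_delta u) mulmx_suml; apply: eq_bigr => i _.
by rewrite -scalemxAl -scalemxAr connection_mxC.
Qed.

Lemma connection_mx_gram u : connection_mx u x *m g x = koszul_mx u x.
Proof. by rewrite connection_mxE -mulmxA mulVmx // mulmx1. Qed.

(** The connection is metric: the last two terms of Koszul's formula are together
    skew in the second and third arguments. *)
Lemma connection_mx_compat u :
  connection_mx u x *m g x + g x *m (connection_mx u x)^T = 'D_u g x.
Proof.
have gx : (g x)^T = g x by exact: nbhs_singleton gsym.
rewrite -{2}gx -trmx_mul connection_mx_gram; apply/matrixP => i l.
have sym : 'D_u g x l i = 'D_u g x i l by rewrite -[in LHS](derive_sym u) [LHS]mxE.
rewrite [LHS]mxE [koszul_mx u x i l]mxE [(koszul_mx u x)^T i l]mxE.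
rewrite [koszul_mx u x l i]mxE sym; lra.
Qed.

End AtPoint.

Lemma smooth_on_connection_mx (U : set 'rV[R]_m) u : open U -> smooth_on U g ->
  (forall x, U x -> g x \in unitmx) -> smooth_on U (connection_mx u).
Proof.
move=> oU sg ug.
suff sk : smooth_on U (koszul_mx u).
  apply: (smooth_on_eq oU _ (smooth_on_mulmx oU sk (smooth_on_invmx oU ug sg))).
  by move=> x _; rewrite connection_mxE.
apply/(smooth_on_entryP _ oU) => i l.
have sD v := (smooth_on_entryP _ oU).1 (smooth_on_derive v sg).
have sE v j : smooth_on U (fun x => (u *m 'D_v g x) 0 j).
  apply: (smooth_on_entryP _ oU).1; apply: smooth_on_mulmx => //.
    exact: smooth_on_cst.
  exact: smooth_on_derive.
have := smooth_onM oU (smooth_on_cst U (2^-1 : R^o)) (smooth_onD oU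
  (smooth_onD oU (sD u i l) (sE (frame R i) l))
  (smooth_onM oU (smooth_on_cst U (-1 : R^o)) (sE (frame R l) i))).
by apply: smooth_on_eq => // x _; rewrite [RHS]mxE mulN1r.
Qed.

End Connection.

(** * Parallelism of the complex structure *)

Section Kahler.
Variables (R : realType) (k : nat) (h : 'rV[R]_k -> 'M[R]_k) (J : 'M[R]_k).
Variable W : set 'rV[R]_k.
Hypotheses (oW : open W) (sh : smooth_on W h).
Hypothesis hsym : forall y, W y -> (h y)^T = h y.
Hypothesis hunit : forall y, W y -> h y \in unitmx.
Hypothesis JJ : J *m J = - 1%:M.
Hypothesis hJ : forall y v w, W y -> inner h y (v *m J) (w *m J) = inner h y v w.
Hypothesis dJ : forall y u v w, W y ->
  let omega v w y := inner h y (v *m J) w in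
  'D_u (omega v w) y + 'D_v (omega w u) y + 'D_w (omega u v) y = 0.

Lemma gram_J y : W y -> J *m h y *m J^T = h y.
Proof.
move=> Wy; apply: eq_bilinear_mx => v w; have := hJ v w Wy.
by rewrite /inner trmx_mul !mulmxA.
Qed.

Lemma gram_J_skew y : W y -> J *m h y = - (h y *m J^T).
Proof. by move=> Wy; rewrite -{1}(gram_J Wy) !mulmxA JJ mulNmx mul1mx mulNmx. Qed.

(** J is parallel.  As J is constant in the chart, Koszul's formula gives
    [2 <(nabla_v J) w, z> = d omega(v, w, z) - d omega(v, Jw, Jz)], and omega is
    closed. *)
Lemma connection_mx_J v y : W y ->
  connection_mx h v y *m J = J *m connection_mx h v y.
Proof.
move=> Wy; have dh := smooth_on_differentiable sh Wy.
have dhv u : derivable h y u by exact: diff_derivable.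
have nW : nbhs y W by exact: open_nbhs_nbhs.
have hs : \forall z \near y, (h z)^T = h z by apply: filterS nW.
pose b (a v w : 'rV[R]_k) : R := (v *m 'D_a h y *m w^T) 0 0.
have JN (u : 'rV[R]_k) : u *m J *m J = - u by rewrite -mulmxA JJ mulmxN mulmx1.
have bN a u w : b a (- u) w = - b a u w by rewrite /b !mulNmx mxE.
have bS a u w : b a u w = b a w u by exact: derive_symE.
have bJ a u w : b a (u *m J) (w *m J) = b a u w.
  have e : J *m 'D_a h y *m J^T = 'D_a h y.
    rewrite -derive_mulmxl // -derive_mulmxr; last exact: derivable_mulmx.
    by apply: near_eq_derive; apply: filterS nW => z Wz; rewrite gram_J.
  by rewrite /b -[in RHS]e trmx_mul !mulmxA.
have bJ1 a u w : b a (u *m J) w = - b a u (w *m J).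
  by have := bJ a (u *m J) w; rewrite JN bN => <-.
have cl u1 u2 u3 : b u1 (u2 *m J) u3 + b u2 (u3 *m J) u1 + b u3 (u1 *m J) u2 = 0.
  by have := dJ u1 u2 u3 Wy; rewrite /= !derive_inner.
have hinj (A B : 'M[R]_k) : A *m h y = B *m h y -> A = B.
  by move=> AB; rewrite -[A](mulmxK (hunit Wy)) AB mulmxK // hunit.
apply: hinj; have := connection_mx_gram (hunit Wy) v.
move: (connection_mx h v y) => C CK.
rewrite -!mulmxA gram_J_skew // mulmxN (mulmxA C) CK.
apply: eq_bilinear_mx => w z; rewrite mulmxN mulNmx mxE !mulmxA.
have -> : w *m koszul_mx h v y *m J^T *m z^T = w *m koszul_mx h v y *m (z *m J)^T.
  by rewrite trmx_mul mulmxA.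
rewrite (koszul_mxE v w (z *m J) dh) (koszul_mxE v (w *m J) z dh).
have alg (A1 A2 A3 B1 B2 B3 X1 X2 X3 : R) : B1 + X1 + X2 = 0 -> - A1 - X3 + A3 = 0 ->
    B1 = - A1 -> A2 = X1 -> X2 = - B3 -> B2 = X3 ->
    - (2^-1 * (A1 + A2 - A3)) = 2^-1 * (B1 + B2 - B3) by lra.
(* d omega (v, w, z) and d omega (v, Jw, Jz), both zero. *)
have c1 := cl v w z; have c2 := cl v (w *m J) (z *m J).
rewrite (JN w) (JN z) (bN v) (bN (w *m J)) (bJ (z *m J)) in c2.
exact: alg c1 c2 (bJ1 v w z) (bS w v (z *m J)) (bJ1 z v w) (bS (w *m J) v z).
Qed.

End Kahler.

(** * Isometric immersions *)

Section Immersion.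
Variables (R : realType) (m k : nat).
Variables (g : 'rV[R]_m -> 'M[R]_m) (h : 'rV[R]_k -> 'M[R]_k).
Variable F : 'rV[R]_m -> 'rV[R]_k.
Variables (U : set 'rV[R]_m) (W : set 'rV[R]_k).
Hypotheses (oU : open U) (oW : open W).
Hypotheses (sg : smooth_on U g) (sh : smooth_on W h) (sF : smooth_on U F).
Hypothesis FW : forall x, U x -> W (F x).
Hypotheses (gsym : forall x, U x -> (g x)^T = g x).
Hypotheses (gunit : forall x, U x -> g x \in unitmx).
Hypothesis hsym : forall y, W y -> (h y)^T = h y.
Hypothesis hunit : forall y, W y -> h y \in unitmx.
Hypothesis iso : forall x v w, U x ->
  inner g x v w = inner h (F x) ('D_v F x) ('D_w F x).
Implicit Types (x v w z : 'rV[R]_m).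

Definition differential_mx x : 'M[R]_(m, k) := \matrix_i 'D_(frame R i) F x.

Local Notation P := differential_mx.

(** The connection matrix of the target, pulled back along F. *)
Definition pullback_mx v x : 'M[R]_k := connection_mx h ('D_v F x) (F x).

(** The i-th row is the ambient covariant derivative along v of the i-th coordinate
    field dF(e_i); its normal part is the second fundamental form. *)
Definition second_derivative_mx v x : 'M[R]_(m, k) :=
  'D_v P x + P x *m pullback_mx v x.

Local Notation C := pullback_mx.
Local Notation Q := second_derivative_mx.

Let nU x : U x -> nbhs x U. Proof. by move=> Ux; exact: open_nbhs_nbhs. Qed.
Let nW y : W y -> nbhs y W. Proof. by move=> Wy; exact: open_nbhs_nbhs. Qed.
Let dF x : U x -> differentiable F x.
Proof. exact: smooth_on_differentiable. Qed.
Let dh y : W y -> differentiable h y.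
Proof. exact: smooth_on_differentiable. Qed.
Let dg x : U x -> differentiable g x.
Proof. exact: smooth_on_differentiable. Qed.
Let hS y : W y -> \forall z \near y, (h z)^T = h z.
Proof. by move=> /nW; apply: filterS. Qed.
Let gS y : U y -> \forall z \near y, (g z)^T = g z.
Proof. by move=> /nU; apply: filterS. Qed.

Lemma derive_differential_mx x v : U x -> 'D_v F x = v *m P x.
Proof.
move=> Ux; rewrite (derive_frame v (dF Ux)) mulmx_sum_row.
by apply: eq_bigr => i _; rewrite rowK.
Qed.

Lemma smooth_on_differential_mx : smooth_on U P.
Proof.
apply/(smooth_on_entryP _ oU) => i j.
have := (smooth_on_entryP _ oU).1 (smooth_on_derive (frame R i) sF) 0 j.
by apply: smooth_on_eq => // x _; rewrite [RHS]mxE.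
Qed.

Let dP x v : U x -> derivable P x v.
Proof. exact: smooth_on_derivable smooth_on_differential_mx. Qed.

Lemma smooth_on_pullback_gram : smooth_on U (fun x => h (F x)).
Proof. exact: (smooth_on_comp_mx oU oW FW sF sh). Qed.

Let dhF x v : U x -> derivable (fun x => h (F x)) x v.
Proof. exact: smooth_on_derivable smooth_on_pullback_gram. Qed.

Lemma smooth_on_pullback_mx v : smooth_on U (C v).
Proof.
have sD i : smooth_on U (fun x => 'D_v F x 0 i).
  exact: (smooth_on_entryP _ oU).1 (smooth_on_derive v sF) 0 i.
have sC i : smooth_on U (fun x => connection_mx h (frame R i) (F x)).
  by apply: (smooth_on_comp_mx oU oW FW sF); exact: smooth_on_connection_mx.
have := smooth_on_sum (index_enum _) xpredT oU (fun i => smooth_onZ oU (sD i) (sC i)).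
apply: smooth_on_eq => // x Ux.
by rewrite /pullback_mx [RHS]connection_mx_frame; [|exact: dh (FW Ux)|exact: hS (FW Ux)].
Qed.

Lemma smooth_on_second_derivative_mx v : smooth_on U (Q v).
Proof.
apply: smooth_onD => //; first exact: smooth_on_derive smooth_on_differential_mx.
apply: smooth_on_mulmx => //; first exact: smooth_on_differential_mx.
exact: smooth_on_pullback_mx.
Qed.

Lemma derive_pullback_gram x v : U x -> 'D_v (fun x => h (F x)) x =
  C v x *m h (F x) + h (F x) *m (C v x)^T.
Proof.
move=> Ux; have Wx := FW Ux.
rewrite (derive_comp_rV v (dF Ux) (dh Wx)).
by rewrite -(connection_mx_compat (dh Wx) (hS Wx) (hunit Wx)).
Qed.

(** Compatibility of the pulled-back connection with the metric, for the
    pairing of the rows of V with the coordinate frame. *)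
Lemma derive_tangential p (V : 'rV[R]_m -> 'M[R]_(p, k)) x v :
  U x -> derivable V x v ->
  'D_v (fun x => V x *m h (F x) *m (P x)^T) x =
  ('D_v V x + V x *m C v x) *m h (F x) *m (P x)^T
    + V x *m h (F x) *m (Q v x)^T.
Proof.
move=> Ux dV.
have dPT : derivable (fun x => (P x)^T) x v.
  apply: (@smooth_on_derivable _ _ _ U) => //.
  by apply: smooth_on_trmx => //; exact: smooth_on_differential_mx.
rewrite (derive_mulmx (derivable_mulmx dV (dhF Ux)) dPT).
rewrite (derive_mulmx dV (dhF Ux)) (derive_trmx (dP Ux)).
rewrite derive_pullback_gram // /second_derivative_mx.
move: ('D_v V x) ('D_v P x) (C v x) (P x) (V x) (h (F x)) => DV DP c p' v' h'.
rewrite [(DP + _)^T]linearD /= trmx_mul !mulmxDr !mulmxDl !mulmxA -!addrA.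
by congr (_ + (_ + _)); rewrite addrC.
Qed.

(** Symmetry of second derivatives in the source, and absence of torsion in the
    target. *)
Lemma second_derivativeC x v w : U x -> w *m Q v x = v *m Q w x.
Proof.
move=> Ux.
have near_D u : \forall y \near x, u *m P y = 'D_u F y.
  by apply: filterS (nU Ux) => y Uy; rewrite derive_differential_mx.
have e1 : w *m 'D_v P x = v *m 'D_w P x.
  rewrite -(derive_mulmxl w (dP Ux)) -(derive_mulmxl v (dP (v := w) Ux)).
  rewrite (near_eq_derive v (near_D w)) (near_eq_derive w (near_D v)).
  exact: derive_commute_mx Ux sF.
have e2 : w *m P x *m C v x = v *m P x *m C w x.
  rewrite -(derive_differential_mx w Ux) -(derive_differential_mx v Ux).
  exact: connection_mxC (dh (FW Ux)) (hS (FW Ux)) _ _.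
by rewrite (mulmxDr w) (mulmxDr v) e1 (mulmxA w) (mulmxA v) e2.
Qed.

Lemma gram_differential_mx x : U x -> g x = P x *m h (F x) *m (P x)^T.
Proof.
move=> Ux; apply: eq_bilinear_mx => v w; have := iso v w Ux; rewrite /inner => ->.
rewrite (derive_differential_mx w Ux) (derive_differential_mx v Ux).
by rewrite trmx_mul !mulmxA.
Qed.

(** Gauss: the tangential part of the ambient derivative of the coordinate frame
    is given by the Levi-Civita connection of the induced metric, as both are
    torsion-free and metric. *)
Lemma gauss_formula x v : U x ->
  Q v x *m h (F x) *m (P x)^T = connection_mx g v x *m g x.
Proof.
move=> Ux.
pose M v := Q v x *m h (F x) *m (P x)^T - connection_mx g v x *m g x.
have skew u : (M u)^T = - M u.
  have e : 'D_u g x = Q u x *m h (F x) *m (P x)^T + P x *m h (F x) *m (Q u x)^T.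
    rewrite -(derive_tangential Ux (dP (v := u) Ux)); apply: near_eq_derive.
    by apply: filterS (nU Ux) => y Uy; exact: gram_differential_mx.
  have eA : (Q u x *m h (F x) *m (P x)^T)^T = P x *m h (F x) *m (Q u x)^T.
    by rewrite trmx_mul trmx_mul trmxK (hsym (FW Ux)) mulmxA.
  have eB : (connection_mx g u x *m g x)^T = g x *m (connection_mx g u x)^T.
    by rewrite trmx_mul (gsym Ux).
  have := connection_mx_compat (dg Ux) (gS Ux) (gunit Ux) u.
  rewrite e -eA -eB /M; move: (_ *m (P x)^T) (_ *m g x) => A B AB.
  have e' : A^T = B + B^T - A by rewrite AB addrC addKr.
  by rewrite [LHS]linearB /= e' addrAC addrK opprB.
pose e u w z := (w *m M u *m z^T) 0 0.
have e0 : forall u w z, e u w z = 0.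
  apply: sym_skew_eq0 => u w z; rewrite /e.
    suff -> : w *m M u = u *m M w by [].
    rewrite /M (mulmxBr w) (mulmxBr u) !(mulmxA w) !(mulmxA u).
    by rewrite (second_derivativeC u w Ux) (connection_mxC (dg Ux) (gS Ux) w u).
  by rewrite bilinear_trmx skew mulmxN mulNmx [LHS]mxE.
apply/eqP; rewrite -subr_eq0 -/(M v); apply/eqP; apply: eq_bilinear_mx => w z.
by rewrite mulmx0 mul0mx [RHS]mxE; exact: e0.
Qed.

Lemma tangent_partE V x : tangent_part g h F V x =
  V x *m h (F x) *m (P x)^T *m invmx (g x).
Proof.
congr (_ *m _); apply/rowP => j; rewrite [LHS]mxE /inner.
have -> : 'D_(frame R j) F x = row j (P x) by rewrite rowK.
by rewrite tr_row colE mulmxA -colE [LHS]mxE.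
Qed.

Lemma normal_partE V x : U x ->
  normal_part g h F V x = V x - tangent_part g h F V x *m P x.
Proof. by move=> Ux; rewrite /normal_part derive_differential_mx. Qed.

Lemma normal_part_normal V x : U x ->
  normal_part g h F V x *m h (F x) *m (P x)^T = 0.
Proof.
move=> Ux; rewrite normal_partE // tangent_partE !mulmxBl.
rewrite -(mulmxA _ (P x)) -(mulmxA _ (P x *m _)) -(gram_differential_mx Ux).
by rewrite -(mulmxA _ (invmx _)) mulVmx ?gunit // mulmx1 subrr.
Qed.

Lemma cov_alongE V v x : U x ->
  cov_along h F V v x = 'D_v V x + V x *m C v x.
Proof. by move=> Ux; rewrite /cov_along christoffelE; last exact: dh (FW Ux). Qed.

Lemma second_formE v w x : U x ->
  second_form g h F v w x = w *m Q v x - w *m connection_mx g v x *m P x.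
Proof.
move=> Ux.
have e : cov_along h F ('D_w F) v x = w *m Q v x.
  rewrite cov_alongE // (mulmxDr w) -(derive_mulmxl w (dP Ux)).
  rewrite (derive_differential_mx w Ux) -mulmxA; congr (_ + _).
  by apply: near_eq_derive; apply: filterS (nU Ux) => y; exact: derive_differential_mx.
rewrite /second_form normal_partE // tangent_partE e.
rewrite -(mulmxA w) -(mulmxA w) gauss_formula //.
by rewrite (mulmxA w) mulmxK ?gunit.
Qed.

Lemma shape_gram V v x : U x -> V x *m h (F x) *m (P x)^T = 0 ->
  shape g h F V x v *m g x = V x *m h (F x) *m (Q v x)^T.
Proof.
move=> Ux nV; rewrite /shape mulmxKV ?gunit //; apply/rowP => j.
rewrite [LHS]mxE /inner second_formE //.
have flip (a b : 'rV[R]_k) : (a *m h (F x) *m b^T) 0 0 = (b *m h (F x) *m a^T) 0 0.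
  by rewrite bilinear_trmx (hsym (FW Ux)).
rewrite flip linearB /= trmx_mul trmx_mul mulmxBr (mulmxA _ (P x)^T) nV mul0mx subr0.
by rewrite mulmxA trmx_delta -colE [LHS]mxE.
Qed.

Lemma smooth_on_tangent_part V : smooth_on U V -> smooth_on U (tangent_part g h F V).
Proof.
move=> sV.
have := smooth_on_mulmx oU (smooth_on_mulmx oU (smooth_on_mulmx oU sV
  smooth_on_pullback_gram) (smooth_on_trmx oU smooth_on_differential_mx))
  (smooth_on_invmx oU gunit sg).
by apply: smooth_on_eq => // y _; rewrite tangent_partE.
Qed.

(** If the ambient derivative of V = T + N is normal, the tangential parts of the
    derivatives of T and N cancel.  They are [nabla_v T], by Gauss, and [- A_N v],
    by Weingarten. *)
Lemma cov_tangent_part V x v : smooth_on U V -> U x ->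
  cov_along h F V v x *m h (F x) *m (P x)^T = 0 ->
  cov g (tangent_part g h F V) v x = shape g h F (normal_part g h F V) x v.
Proof.
move=> sV Ux; rewrite cov_alongE // (covE _ _ (dg Ux)) => V0.
set T := tangent_part g h F V; set N := normal_part g h F V.
have sT : smooth_on U T by exact: smooth_on_tangent_part.
have sN : smooth_on U N.
  have := smooth_onB oU sV (smooth_on_mulmx oU sT smooth_on_differential_mx).
  by apply: smooth_on_eq => // y Uy; rewrite /N normal_partE.
have dT : derivable T x v := smooth_on_derivable sT Ux.
have dN : derivable N x v := smooth_on_derivable sN Ux.
have N0 y : U y -> N y *m h (F y) *m (P y)^T = 0 by exact: normal_part_normal.
(* Weingarten: differentiate the equation saying that N is normal. *)
have DN : ('D_v N x + N x *m C v x) *m h (F x) *m (P x)^T =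
    - (N x *m h (F x) *m (Q v x)^T).
  apply/eqP; rewrite -addr_eq0 -(derive_tangential Ux dN); apply/eqP.
  rewrite -[RHS](derive_cst (0 : 'M[R]_(1, m)) x v); apply: near_eq_derive.
  by apply: filterS (nU Ux) => y; exact: N0.
have VE y : U y -> V y = T y *m P y + N y.
  by move=> Uy; rewrite /N normal_partE // addrC subrK.
have dTP : derivable (fun y => T y *m P y) x v := derivable_mulmx dT (dP Ux).
have DV : 'D_v V x = 'D_v T x *m P x + T x *m 'D_v P x + 'D_v N x.
  rewrite -(derive_mulmx dT (dP Ux)) -(deriveD dTP dN); apply: near_eq_derive.
  by apply: filterS (nU Ux) => y; exact: VE.
have ginj (A B : 'rV[R]_m) : A *m g x = B *m g x -> A = B.
  by move=> AB; rewrite -[A](mulmxK (gunit Ux)) AB mulmxK ?gunit.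
apply: ginj; rewrite (shape_gram v Ux (N0 x Ux)); apply/eqP; rewrite -subr_eq0 -DN.
apply/eqP; rewrite -[RHS]V0 DV (VE x Ux).
have eG : ('D_v T x + T x *m connection_mx g v x) *m g x =
    'D_v T x *m (P x *m h (F x) *m (P x)^T) + T x *m (Q v x *m h (F x) *m (P x)^T).
  by rewrite mulmxDl -(mulmxA (T x)) -gauss_formula // -gram_differential_mx.
rewrite eG /second_derivative_mx.
move: ('D_v T x) ('D_v P x) ('D_v N x) (C v x) (P x) (h (F x)) (T x) (N x).
move=> DT DP DN' c p' h' t n.
rewrite !(mulmxDl, mulmxDr, mulmxA, addrA); congr (_ + _).
by rewrite [RHS]addrAC.
Qed.

Lemma shape_sym V x v w : U x -> V x *m h (F x) *m (P x)^T = 0 ->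
  (shape g h F V x v *m g x *m w^T) 0 0 = (shape g h F V x w *m g x *m v^T) 0 0.
Proof.
move=> Ux nV.
have e (a b : 'rV[R]_m) :
    shape g h F V x a *m g x *m b^T = V x *m h (F x) *m (b *m Q a x)^T.
  by rewrite (shape_gram a Ux nV) trmx_mul mulmxA.
suff E : shape g h F V x v *m g x *m w^T = shape g h F V x w *m g x *m v^T.
  exact: (congr1 (fun A : 'M[R]_1 => A 0 0) E).
apply: (etrans (e v w)); apply: etrans (esym (e w v)).
by rewrite (second_derivativeC v w Ux).
Qed.

Lemma trace_shape V x : U x ->
  \sum_i shape g h F V x (frame R i) 0 i
  = 2 * inner h (F x) (mean_curvature g h F x) (V x).
Proof.
move=> Ux; rewrite /mean_curvature /inner -!scalemxAl.
rewrite [in RHS]mxE mulVKf ?pnatr_eq0 // !mulmx_suml summxE.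
apply: eq_bigr => i _; rewrite /shape [LHS]mxE !mulmx_suml summxE.
apply: eq_bigr => j _.
rewrite -!scalemxAl [RHS]mxE [X in X * _]mxE mulrC; congr (_ * _).
have gi : (invmx (g x))^T = invmx (g x) by rewrite trmx_inv (gsym Ux).
by rewrite -[in LHS]gi [LHS]mxE.
Qed.

Lemma smooth_on_mean_curvature : smooth_on U (mean_curvature g h F).
Proof.
have sginv := smooth_on_invmx oU gunit sg.
have sB v w : smooth_on U (second_form g h F v w).
  have sG : smooth_on U (connection_mx g v) by exact: smooth_on_connection_mx.
  have wc := smooth_on_cst U w.
  have := smooth_onB oU (smooth_on_mulmx oU wc (smooth_on_second_derivative_mx v))
    (smooth_on_mulmx oU (smooth_on_mulmx oU wc sG) smooth_on_differential_mx).
  by apply: smooth_on_eq => // x Ux; rewrite second_formE.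
apply: (smooth_onZ oU (smooth_on_cst U (2^-1 : R^o))).
apply: smooth_on_sum => // i; apply: smooth_on_sum => // j.
by apply: smooth_onZ => //; exact: (smooth_on_entryP _ oU).1.
Qed.

Lemma mean_curvature_normal x : U x ->
  mean_curvature g h F x *m h (F x) *m (P x)^T = 0.
Proof.
move=> Ux; rewrite /mean_curvature -!scalemxAl !mulmx_suml big1 ?scaler0 // => i _.
rewrite !mulmx_suml big1 // => j _.
by rewrite -!scalemxAl normal_part_normal // scaler0.
Qed.

End Immersion.

(** * The Bochner formula on a surface *)

Section Bochner.
Variables (R : realType) (m : nat) (g : 'rV[R]_m -> 'M[R]_m).
Variables (U : set 'rV[R]_m) (X : 'rV[R]_m -> 'rV[R]_m).
Hypotheses (oU : open U) (sg : smooth_on U g) (sX : smooth_on U X).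
Hypotheses (gsym : forall x, U x -> (g x)^T = g x).
Hypotheses (gunit : forall x, U x -> g x \in unitmx).
Implicit Types (x v w z : 'rV[R]_m).

Local Notation G := (connection_mx g).

Let nU x : U x -> nbhs x U. Proof. by move=> Ux; exact: open_nbhs_nbhs. Qed.
Let dg x : U x -> differentiable g x.
Proof. exact: smooth_on_differentiable. Qed.
Let gS x : U x -> \forall z \near x, (g z)^T = g z.
Proof. by move=> /nU; apply: filterS. Qed.
Let sG v : smooth_on U (G v). Proof. exact: smooth_on_connection_mx. Qed.
Let dG u v x : U x -> derivable (G u) x v. Proof. exact: smooth_on_derivable. Qed.

(** The matrix of [z |-> R(v, w) z]. *)
Definition curvature_mx v w x : 'M[R]_m :=
  'D_v (G w) x + G w x *m G v x - ('D_w (G v) x + G v x *m G w x).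

(** The matrix of [v |-> nabla_v X]. *)
Definition cov_mx x : 'M[R]_m := \matrix_i cov g X (frame R i) x.

(** [w *m cov2_mx v x] is the second covariant derivative of X at (v, w). *)
Definition cov2_mx v x : 'M[R]_m :=
  'D_v cov_mx x + cov_mx x *m G v x - G v x *m cov_mx x.

Lemma curvatureE x v w z : U x -> curvature g x v w z = z *m curvature_mx v w x.
Proof.
move=> Ux.
have e u1 u2 : cov g (fun y => cov g (fun=> z) u2 y) u1 x =
    z *m ('D_u1 (G u2) x + G u2 x *m G u1 x).
  have near_e : \forall y \near x, cov g (fun=> z) u2 y = z *m G u2 y.
    apply: filterS (nU Ux) => y Uy.
    by rewrite (covE _ _ (dg Uy)) (derive_cst z) add0r.
  rewrite (covE _ _ (dg Ux)) (near_eq_derive u1 near_e).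
  rewrite (nbhs_singleton near_e) (derive_mulmxl z (dG (u := u2) Ux)).
  by rewrite mulmxDr mulmxA.
exact: etrans (congr2 (fun a b => a - b) (e v w) (e w v)) (esym (mulmxBr _ _ _)).
Qed.

Lemma curvature_mxC v w x : curvature_mx w v x = - curvature_mx v w x.
Proof. by rewrite /curvature_mx opprB. Qed.

(** R(v, w) is skew-adjoint: differentiate [D_w g = Gamma_w g + g Gamma_w^T] along v
    and use the symmetry of the second derivatives of g. *)
Lemma curvature_mx_skew v w x : U x ->
  (curvature_mx v w x *m g x)^T = - (curvature_mx v w x *m g x).
Proof.
move=> Ux.
have compat u y : U y -> 'D_u g y = G u y *m g y + (G u y *m g y)^T.
  move=> Uy; rewrite trmx_mul (gsym Uy).
  by rewrite (connection_mx_compat (dg Uy) (gS Uy) (gunit Uy)).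
have dgv u : derivable g x u by exact: diff_derivable (dg Ux).
have DD u1 u2 : 'D_u1 ('D_u2 g) x =
    'D_u1 (G u2) x *m g x + G u2 x *m (G u1 x *m g x + (G u1 x *m g x)^T)
    + ('D_u1 (G u2) x *m g x + G u2 x *m (G u1 x *m g x + (G u1 x *m g x)^T))^T.
  have near_e : \forall y \near x, 'D_u2 g y = G u2 y *m g y + (G u2 y *m g y)^T.
    by apply: filterS (nU Ux) => y; exact: compat.
  have dGg := derivable_mulmx (dG (u := u2) Ux) (dgv u1).
  rewrite (near_eq_derive u1 near_e) deriveD; first last.
  - apply: (@smooth_on_derivable _ _ _ U) => //; apply: smooth_on_trmx => //.
    exact: smooth_on_mulmx.
  - exact: dGg.
  rewrite (derive_trmx dGg) (derive_mulmx (dG (u := u2) Ux) (dgv u1)).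
  by rewrite (compat u1 x Ux).
have sT : (G w x *m (G v x *m g x)^T)^T = G v x *m (G w x *m g x)^T.
  by rewrite trmx_mul trmxK trmx_mul (gsym Ux) mulmxA.
have -> : curvature_mx v w x *m g x =
    'D_v (G w) x *m g x + G w x *m (G v x *m g x)
    - ('D_w (G v) x *m g x + G v x *m (G w x *m g x)).
  by rewrite /curvature_mx mulmxBl !mulmxDl !mulmxA.
have cancel (p q p' q' s s' : 'M[R]_m) : s^T = s' ->
    p + (q + s) + (p + (q + s))^T = p' + (q' + s') + (p' + (q' + s'))^T ->
    (p + q - (p' + q'))^T = - (p + q - (p' + q')).
  move=> <- /matrixP e; apply/matrixP => i j.
  by have := e i j; rewrite !mxE; lra.
apply: (cancel _ _ _ _ _ _ sT); rewrite -(mulmxDr (G w x)) -(mulmxDr (G v x)).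
exact: etrans (esym (DD v w)) (etrans (derive_commute_mx v w oU Ux sg) (DD w v)).
Qed.

Lemma cov_mxE v x : U x -> cov g X v x = v *m cov_mx x.
Proof.
move=> Ux; rewrite mulmx_sum_row (covE _ _ (dg Ux)).
rewrite (derive_frame v (smooth_on_differentiable sX Ux)).
rewrite (connection_mx_frame (dg Ux) (gS Ux)) mulmx_sumr -big_split.
apply: eq_bigr => i _; rewrite /= rowK (covE _ _ (dg Ux)).
by rewrite -scalemxAr -scalerDr.
Qed.

Lemma smooth_on_cov_mx : smooth_on U cov_mx.
Proof.
apply/(smooth_on_entryP _ oU) => i j.
have := smooth_onD oU (smooth_on_derive (frame R i) sX)
  (smooth_on_mulmx oU sX (sG (frame R i))).
move=> /(smooth_on_entryP _ oU)/(_ 0 j); apply: smooth_on_eq => // x Ux.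
by rewrite [RHS]mxE (covE _ _ (dg Ux)).
Qed.

Let dA x v : U x -> derivable cov_mx x v.
Proof. exact: smooth_on_derivable smooth_on_cov_mx. Qed.

(** Ricci's identity: in the difference of the second covariant derivatives of X,
    the terms with derivatives of X cancel, by symmetry of second derivatives and
    absence of torsion. *)
Lemma cov2_mx_commute v w x : U x ->
  w *m cov2_mx v x - v *m cov2_mx w x = X x *m curvature_mx v w x.
Proof.
move=> Ux.
have dX u y : U y -> derivable X y u by exact: smooth_on_derivable.
have eA u y : U y -> u *m cov_mx y = 'D_u X y + X y *m G u y.
  by move=> Uy; rewrite -(cov_mxE _ Uy) (covE _ _ (dg Uy)).
have eD u1 u2 : u2 *m 'D_u1 cov_mx x =
    'D_u1 ('D_u2 X) x + ('D_u1 X x *m G u2 x + X x *m 'D_u1 (G u2) x).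
  have dXG := derivable_mulmx (dX u1 x Ux) (dG (u := u2) Ux).
  have dDX : derivable ('D_u2 X) x u1.
    exact: smooth_on_derivable (smooth_on_derive u2 sX) Ux.
  rewrite -(derive_mulmx (dX u1 x Ux) (dG Ux)) -(deriveD dDX dXG).
  rewrite -(derive_mulmxl u2 (dA Ux)); apply: near_eq_derive.
  by apply: filterS (nU Ux) => y; exact: eA.
have e u1 u2 : u2 *m cov2_mx u1 x =
    'D_u1 ('D_u2 X) x + ('D_u1 X x *m G u2 x + X x *m 'D_u1 (G u2) x)
    + ('D_u2 X x *m G u1 x + X x *m (G u2 x *m G u1 x)) - u2 *m G u1 x *m cov_mx x.
  rewrite /cov2_mx mulmxBr mulmxDr eD (mulmxA u2) (eA u2 x Ux).
  by rewrite (mulmxDl _ _ (G u1 x)) -(mulmxA (X x)) (mulmxA u2 (G u1 x)).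
have cancel (s d1 d2 p1 p2 q1 q2 t : 'rV[R]_m) :
    s + (d1 + p1) + (d2 + q1) - t - (s + (d2 + p2) + (d1 + q2) - t) =
    p1 + q1 - (p2 + q2).
  by apply/rowP => i; rewrite !mxE; ring.
have tC : w *m G v x *m cov_mx x = v *m G w x *m cov_mx x.
  by rewrite (connection_mxC (dg Ux) (gS Ux) w v).
have sC := derive_commute_mx v w oU Ux sX.
apply: (etrans (congr2 (fun a b => a - b) (e v w) (e w v))).
rewrite [in LHS]sC [in LHS]tC cancel.
by rewrite /curvature_mx mulmxBr (mulmxDr (X x)) (mulmxDr (X x)).
Qed.

Lemma derive_pairing p q (Y : 'rV[R]_m -> 'M[R]_(p, m))
    (Z : 'rV[R]_m -> 'M[R]_(q, m)) v x :
  U x -> derivable Y x v -> derivable Z x v ->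
  'D_v (fun y => Y y *m g y *m (Z y)^T) x =
  ('D_v Y x + Y x *m G v x) *m g x *m (Z x)^T
  + Y x *m g x *m ('D_v Z x + Z x *m G v x)^T.
Proof.
move=> Ux dY dZ; have dgv : derivable g x v by exact: diff_derivable (dg Ux).
have dZT : derivable (fun y => (Z y)^T) x v.
  apply/derivable_mxP => i j; have -> : (fun y => (Z y)^T i j) = fun y => Z y j i.
    by apply/funext => y; rewrite mxE.
  exact: (derivable_mxP _ _ _).1.
rewrite (derive_mulmx (derivable_mulmx dY dgv) dZT) (derive_mulmx dY dgv).
rewrite (derive_trmx dZ) -(connection_mx_compat (dg Ux) (gS Ux) (gunit Ux) v).
move: ('D_v Y x) ('D_v Z x) (Y x) (Z x) (G v x) (g x) => DY DZ y z c g0.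
rewrite [(DZ + _)^T]linearD /= trmx_mul !mulmxDr !mulmxDl !mulmxA -!addrA.
by congr (_ + (_ + _)); rewrite addrC.
Qed.

Let dXv x v : U x -> derivable X x v. Proof. exact: smooth_on_derivable. Qed.

Lemma derive_mx11 (f : 'rV[R]_m -> 'M[R]_1) x v : derivable f x v ->
  'D_v (fun y => f y 0 0) x = 'D_v f x 0 0.
Proof. exact: derive_entry. Qed.

Lemma derive_normsq w x : U x ->
  'D_w (fun y => normsq g y (X y)) x = 2 * (w *m cov_mx x *m g x *m (X x)^T) 0 0.
Proof.
move=> Ux.
have dg' : derivable g x w by exact: diff_derivable (dg Ux).
have dXT : derivable (fun y => (X y)^T) x w.
  apply: (@smooth_on_derivable _ _ _ U) => //; exact: smooth_on_trmx.
have dQ := derivable_mulmx (derivable_mulmx (dXv Ux) dg') dXT.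
rewrite /normsq /inner (derive_mx11 dQ) (derive_pairing Ux (dXv Ux) (dXv Ux)).
rewrite -(covE _ _ (dg Ux)) (cov_mxE _ Ux).
have -> : X x *m g x *m (w *m cov_mx x)^T = w *m cov_mx x *m g x *m (X x)^T.
  move: (w *m cov_mx x) => y.
  by rewrite -[RHS]mx11_trmx !trmx_mul trmxK (gsym Ux) mulmxA.
by rewrite mxE mulr_natl mulr2n.
Qed.

Lemma hessian_normsq v w x : U x ->
  hessian g (fun y => normsq g y (X y)) x v w =
  2 * ((w *m cov2_mx v x *m g x *m (X x)^T) 0 0
       + (w *m cov_mx x *m g x *m (v *m cov_mx x)^T) 0 0).
Proof.
move=> Ux; have dg' : derivable g x v by exact: diff_derivable (dg Ux).
have dXT : derivable (fun y => (X y)^T) x v.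
  apply: (@smooth_on_derivable _ _ _ U) => //; exact: smooth_on_trmx.
have dwA := derivable_mulmx (derivable_cst w x v) (dA Ux).
have dQ := derivable_mulmx (derivable_mulmx dwA dg') dXT.
have d2 : 'D_v ('D_w (fun y => normsq g y (X y))) x =
    2 * ((w *m 'D_v cov_mx x + w *m cov_mx x *m G v x) *m g x *m (X x)^T
         + w *m cov_mx x *m g x *m (v *m cov_mx x)^T) 0 0.
  have near_e : \forall y \near x, 'D_w (fun y => normsq g y (X y)) y =
      2 * (w *m cov_mx y *m g y *m (X y)^T) 0 0.
    by apply: filterS (nU Ux) => y; exact: derive_normsq.
  rewrite (near_eq_derive v near_e).
  have dQ0 := (derivable_mxP _ _ _).1 dQ 0 0.
  rewrite deriveZ //= (derive_mx11 dQ) (derive_pairing Ux dwA (dXv Ux)).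
  by rewrite (derive_mulmxl w (dA Ux)) -(covE _ _ (dg Ux)) (cov_mxE _ Ux).
rewrite /hessian d2 derive_normsq // christoffelE; last exact: dg Ux.
rewrite /cov2_mx -mulrBr; congr (_ * _).
move: ('D_v cov_mx x) (cov_mx x) (G v x) (g x) (X x)^T => DA A c g0 t.
have -> : w *m (DA + A *m c - c *m A) *m g0 *m t =
    (w *m DA + w *m A *m c) *m g0 *m t - w *m c *m A *m g0 *m t.
  by rewrite mulmxBr mulmxDr !mulmxBl !mulmxA.
move: (_ *m t) (w *m c *m A *m g0 *m t) (_ *m (v *m A)^T) => a b d.
by rewrite !mxE; ring.
Qed.

Hypothesis closed_X : forall x v w, U x ->
  (cov g X v x *m g x *m w^T) 0 0 = (cov g X w x *m g x *m v^T) 0 0.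
Hypothesis div_X : forall x, U x -> \sum_i cov g X (frame R i) x 0 i = 0.

Lemma cov_mx_gram_sym x : U x -> (cov_mx x *m g x)^T = cov_mx x *m g x.
Proof.
move=> Ux; apply: eq_bilinear_mx => v w.
rewrite bilinear_trmx trmxK !mulmxA -!(cov_mxE _ Ux); exact: closed_X.
Qed.

(** The covariant derivative of the symmetric form [<nabla X, .>] is symmetric. *)
Lemma cov2_mx_gram_sym v x : U x -> (cov2_mx v x *m g x)^T = cov2_mx v x *m g x.
Proof.
move=> Ux; have dg' : derivable g x v by exact: diff_derivable (dg Ux).
pose D := 'D_v (fun y => cov_mx y *m g y) x.
have DT : D^T = D.
  rewrite /D -derive_trmx; last exact: derivable_mulmx (dA Ux) dg'.
  by apply: near_eq_derive; apply: filterS (nU Ux) => y; exact: cov_mx_gram_sym.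
have eD : cov2_mx v x *m g x =
    D - (G v x *m (cov_mx x *m g x) + (G v x *m (cov_mx x *m g x))^T).
  rewrite /D (derive_mulmx (dA Ux) dg').
  rewrite -(connection_mx_compat (dg Ux) (gS Ux) (gunit Ux) v).
  rewrite [(G v x *m _)^T]trmx_mul (cov_mx_gram_sym Ux) /cov2_mx.
  move: ('D_v cov_mx x) (cov_mx x) (G v x) (g x) => DA A c g0.
  rewrite mulmxBl mulmxDl (mulmxDr A) !mulmxA.
  move: (DA *m g0) (A *m c *m g0) (A *m g0 *m c^T) (c *m A *m g0) => p q s t.
  by apply/matrixP => i j; rewrite !mxE; ring.
rewrite eD linearB /= DT; congr (_ - _).
by rewrite linearD /= trmxK addrC.
Qed.

(** The trace commutes with covariant derivatives: [tr (A Gamma) = tr (Gamma A)]. *)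
Lemma tr_cov2_mx v x : U x -> \tr (cov2_mx v x) = 0.
Proof.
move=> Ux; rewrite /cov2_mx linearB linearD /= (mxtrace_mulC (cov_mx x)) addrK.
have dAi i : derivable (fun y => cov_mx y i i) x v.
  exact: ((derivable_mxP _ _ _).1 (dA Ux) i i).
have -> : \tr ('D_v cov_mx x) = 'D_v (\sum_i (fun y => cov_mx y i i)) x.
  by rewrite derive_sum //; apply: eq_bigr => i _; rewrite derive_entry //; exact: dA Ux.
rewrite -[RHS](derive_cst (0 : R^o) x v); apply: near_eq_derive.
apply: filterS (nU Ux) => y Uy; rewrite fct_sumE -[RHS](div_X Uy).
by apply: eq_bigr => i _; rewrite mxE.
Qed.

Lemma contraction x (y : 'rV[R]_m) i : U x ->
  \sum_j invmx (g x) i j * (y *m g x *m (frame R j)^T) 0 0 = y 0 i.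
Proof.
move=> Ux; rewrite -[in RHS](mulmxK (gunit Ux) y) [RHS]mxE.
apply: eq_bigr => j _; rewrite trmx_delta -colE [X in _ * X]mxE mulrC.
have gi : (invmx (g x))^T = invmx (g x) by rewrite trmx_inv (gsym Ux).
by rewrite -[in LHS]gi [X in _ * X]mxE.
Qed.

(** Half the Hessian of |X|^2 is [<nabla^2 X, X> + <nabla X, nabla X>].  In the trace
    of the first term, X being closed allows to exchange the last two slots, and
    Ricci's identity to exchange the first two; what is left besides Ric(X, X) is
    the derivative of div X, which vanishes.  The double sum below is Ric(X, X). *)
Lemma bochner x : U x ->
  - (2^-1 * laplacian g (fun y => normsq g y (X y)) x) =
  \sum_i \sum_k X x 0 k * (X x *m curvature_mx (frame R i) (frame R k) x) 0 i
  + normsq_end g x (fun v => cov g X v x).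
Proof.
move=> Ux; rewrite /laplacian mulrN opprK.
have -> : 2^-1 * (\sum_i \sum_j invmx (g x) i j *
      hessian g (fun y => normsq g y (X y)) x (frame R i) (frame R j)) =
    (\sum_i \sum_j invmx (g x) i j *
      (X x *m cov2_mx (frame R i) x *m g x *m (frame R j)^T) 0 0)
    + normsq_end g x (fun v => cov g X v x).
  rewrite mulr_sumr -big_split; apply: eq_bigr => i _.
  rewrite mulr_sumr -big_split; apply: eq_bigr => j _ /=.
  rewrite (hessian_normsq _ _ Ux) mulrCA mulKf ?pnatr_eq0 // mulrDr.
  congr (_ * _ + _ * _).
    rewrite -(mulmxA (frame R j)) -(mulmxA (X x)) bilinear_trmx.
    by rewrite (cov2_mx_gram_sym _ Ux).
  by rewrite /inner !(cov_mxE _ Ux) bilinear_trmx (gsym Ux).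
congr (_ + _).
under eq_bigr => i _ do rewrite contraction //.
(* Ricci's identity, after expanding X at x in the frame. *)
transitivity (\sum_i \sum_k X x 0 k * ((frame R i *m cov2_mx (frame R k) x) 0 i
   + (X x *m curvature_mx (frame R i) (frame R k) x) 0 i)).
  apply: eq_bigr => i _; rewrite {1}(row_sum_delta (X x)) mulmx_suml summxE.
  apply: eq_bigr => k _; rewrite -scalemxAl mxE; congr (_ * _).
  have := cov2_mx_commute (frame R i) (frame R k) Ux.
  by move/eqP; rewrite subr_eq addrC => /eqP ->; rewrite mxE.
under eq_bigr => i _ do under eq_bigr => k _ do rewrite mulrDr.
under eq_bigr => i _ do rewrite big_split.
rewrite big_split exchange_big /= [X in X + _]big1 ?add0r // => k _.
have tr0 : \sum_i (frame R i *m cov2_mx (frame R k) x) 0 i = 0.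
  apply: etrans (tr_cov2_mx (frame R k) Ux).
  by apply: eq_bigr => i _; rewrite -rowE mxE.
by rewrite -mulr_sumr tr0 mulr0.
Qed.

End Bochner.

Section Surface.
Variables (R : realType) (g : 'rV[R]_2 -> 'M[R]_2).
Variables (U : set 'rV[R]_2) (X : 'rV[R]_2 -> 'rV[R]_2).
Hypotheses (oU : open U) (sg : smooth_on U g) (sX : smooth_on U X).
Hypotheses (gsym : forall x, U x -> (g x)^T = g x).
Hypotheses (gunit : forall x, U x -> g x \in unitmx).

Lemma det_mx2 (A : 'M[R]_2) : \det A = A 0 0 * A 1 1 - A 0 1 * A 1 0.
Proof.
rewrite (expand_det_row _ 0) !big_ord_recl big_ord0 /cofactor !det_mx11 !mxE /=.
rewrite /bump /= !addn0 expr0 expr1 mul1r addr0 mulN1r mulrN.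
by congr (_ * A _ _ - A _ _ * A _ _); apply/val_inj.
Qed.

(** In dimension 2 the curvature is skew in both pairs of arguments, hence
    determined by the number [<R(e_0, e_1) e_1, e_0>]. *)
Lemma ricci_surface x : U x ->
  \sum_i \sum_k X x 0 k *
    (X x *m curvature_mx g (frame R i) (frame R k) x) 0 i
  = sectional g x (frame R 0) (frame R 1) * normsq g x (X x).
Proof.
move=> Ux.
have two (F : 'I_2 -> R) : \sum_i F i = F 0 + F 1.
  by rewrite !big_ord_recl big_ord0 addr0; congr (_ + F _); apply/val_inj.
have fr (A : 'M[R]_2) i j : (frame R i *m A *m (frame R j)^T) 0 0 = A i j.
  by rewrite /frame trmx_delta -rowE -colE !mxE.
have entry (v : 'rV[R]_2) (A : 'M[R]_2) i : (v *m A) 0 i = v 0 0 * A 0 i + v 0 1 * A 1 i.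
  by rewrite mxE two.
have mul (A B : 'M[R]_2) i j : (A *m B) i j = A i 0 * B 0 j + A i 1 * B 1 j.
  by rewrite mxE two.
pose M := curvature_mx g (frame R 0) (frame R 1) x.
have C0 i : curvature_mx g (frame R i) (frame R i) x = 0.
  by rewrite /curvature_mx subrr.
have C1 : curvature_mx g (frame R 1) (frame R 0) x = - M by rewrite curvature_mxC.
have skew i j : (M *m g x) j i = - (M *m g x) i j.
  have := curvature_mx_skew oU sg gsym gunit (frame R 0) (frame R 1) Ux.
  by move/matrixP/(_ i j); rewrite [LHS]mxE [RHS]mxE.
have K : sectional g x (frame R 0) (frame R 1)
    = (M *m g x) 1 0 / (g x 0 0 * g x 1 1 - g x 0 1 ^+ 2).
  rewrite /sectional /normsq /inner !fr; congr (_ / _).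
  by rewrite (curvatureE oU sg gunit _ _ _ Ux) -(mulmxA (frame R 1)) fr.
have nX : normsq g x (X x) = X x 0 0 * (X x 0 0 * g x 0 0 + X x 0 1 * g x 1 0)
    + X x 0 1 * (X x 0 0 * g x 0 1 + X x 0 1 * g x 1 1).
  rewrite /normsq /inner mxE two !entry [(X x)^T 0 0]mxE [(X x)^T 1 0]mxE.
  by ring.
have D0 : g x 0 0 * g x 1 1 - g x 0 1 ^+ 2 != 0.
  have := gunit Ux; rewrite unitmxE unitfE det_mx2.
  by rewrite -[in X in _ - _ * X](gsym Ux) mxE expr2.
have h10 : g x 1 0 = g x 0 1 by rewrite -[in LHS](gsym Ux) mxE.
rewrite !two !C0 C1 -/M mulmx0 mulmxN K nX.
rewrite [(0 : 'rV_2) 0 0]mxE [(0 : 'rV_2) 0 1]mxE [(- (X x *m M)) 0 1]mxE !entry.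
have := skew 0 0; have := skew 1 1; have := skew 0 1; rewrite !mul h10.
move: (M 0 0) (M 0 1) (M 1 0) (M 1 1) D0 => m00 m01 m10 m11.
move: (g x 0 0) (g x 0 1) (g x 1 1) (X x 0 0) (X x 0 1) => g0 h g1 X0 X1 D0.
move=> E3 E2 E1.
have {}E1 : m00 * g0 + m01 * h = 0 by lra.
have {}E2 : m10 * h + m11 * g1 = 0 by lra.
have {}E3 : m00 * h + m01 * g1 + (m10 * g0 + m11 * h) = 0 by lra.
apply: (mulIf D0); rewrite [RHS]mulrAC divfK //.
apply/eqP; rewrite -subr_eq0; apply/eqP.
(* The entries of M, multiplied by the determinant of g, are combinations of E1, E2
   and E3: this solves M = (M g) g^-1 without writing the inverse. *)
transitivity (X0 * X1 * (g1 * (m00 * g0 + m01 * h)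
      - h * (m00 * h + m01 * g1 + (m10 * g0 + m11 * h)))
    - X1 ^+ 2 * h * (m10 * h + m11 * g1)
    - X0 ^+ 2 * (g0 * (m00 * h + m01 * g1 + (m10 * g0 + m11 * h))
      - h * (m00 * g0 + m01 * h))
    - X0 * X1 * g0 * (m10 * h + m11 * g1)); first by ring.
by rewrite E1 E2 E3; ring.
Qed.

Hypothesis closed_X : forall x v w, U x ->
  (cov g X v x *m g x *m w^T) 0 0 = (cov g X w x *m g x *m v^T) 0 0.
Hypothesis div_X : forall x, U x -> \sum_i cov g X (frame R i) x 0 i = 0.

Lemma bochner_surface x : U x ->
  - (2^-1 * laplacian g (fun y => normsq g y (X y)) x) =
  sectional g x (frame R 0) (frame R 1) * normsq g x (X x)
  + normsq_end g x (fun v => cov g X v x).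
Proof.
by move=> Ux; rewrite (bochner oU sg sX gsym gunit closed_X div_X Ux) ricci_surface.
Qed.

End Surface.

(** * Totally real immersions with parallel mean curvature *)

Section TotallyReal.
Variables (R : realType) (m k : nat).
Variables (g : 'rV[R]_m -> 'M[R]_m) (h : 'rV[R]_k -> 'M[R]_k) (J : 'M[R]_k).
Variable F : 'rV[R]_m -> 'rV[R]_k.
Variables (U : set 'rV[R]_m) (W : set 'rV[R]_k).
Hypotheses (oU : open U) (oW : open W).
Hypotheses (sg : smooth_on U g) (sh : smooth_on W h) (sF : smooth_on U F).
Hypothesis FW : forall x, U x -> W (F x).
Hypotheses (gsym : forall x, U x -> (g x)^T = g x).
Hypotheses (gunit : forall x, U x -> g x \in unitmx).
Hypothesis hsym : forall y, W y -> (h y)^T = h y.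
Hypothesis hunit : forall y, W y -> h y \in unitmx.
Hypothesis iso : forall x v w, U x ->
  inner g x v w = inner h (F x) ('D_v F x) ('D_w F x).
Hypothesis JJ : J *m J = - 1%:M.
Hypothesis hJ : forall y v w, W y -> inner h y (v *m J) (w *m J) = inner h y v w.
Hypothesis dJ : forall y u v w, W y ->
  let omega v w y := inner h y (v *m J) w in
  'D_u (omega v w) y + 'D_v (omega w u) y + 'D_w (omega u v) y = 0.
Hypothesis real_F : forall x v w, U x ->
  inner h (F x) ('D_v F x *m J) ('D_w F x) = 0.
Hypothesis parallel_H : forall x v, U x ->
  normal_cov g h F (mean_curvature g h F) v x = 0.

Local Notation P := (differential_mx F).
Local Notation H := (mean_curvature g h F).
Let JH x := H x *m J.
Local Notation T := (tangent_part g h F JH).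
Local Notation N := (normal_part g h F JH).

Let sH : smooth_on U H.
Proof. exact: (smooth_on_mean_curvature oU oW sg sh sF FW gsym gunit hsym hunit iso). Qed.

Let sJH : smooth_on U JH.
Proof. by apply: smooth_on_mulmx => //; exact: smooth_on_cst. Qed.

Let DF x v : U x -> 'D_v F x = v *m P x.
Proof. by move=> Ux; rewrite (derive_differential_mx sF). Qed.

Lemma normal_JH x : U x -> N x *m h (F x) *m (P x)^T = 0.
Proof. exact: (normal_part_normal sF gunit iso). Qed.

(** The ambient derivative of H is tangent since H is parallel in the normal
    bundle, and J is parallel and maps tangent vectors to normal ones. *)
Lemma cov_along_JH_normal x v : U x ->
  cov_along h F JH v x *m h (F x) *m (P x)^T = 0.
Proof.
move=> Ux; have Wx := FW Ux.
have cE (V : 'rV[R]_m -> 'rV[R]_k) := cov_alongE sh FW V v Ux.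
have dH : derivable H x v := smooth_on_derivable sH Ux.
have cJ : cov_along h F JH v x = cov_along h F H v x *m J.
  rewrite cE cE /JH (derive_mulmxr J dH) mulmxDl -!mulmxA; congr (_ + _ *m _).
  by rewrite /pullback_mx (connection_mx_J oW sh hsym hunit JJ hJ dJ).
have [t tE] : exists t : 'rV[R]_m, cov_along h F H v x = t *m P x.
  have := parallel_H v Ux; rewrite /normal_cov (normal_partE g h sF _ Ux).
  by move/eqP; rewrite subr_eq0 => /eqP ->; eexists.
have PJP : P x *m J *m h (F x) *m (P x)^T = 0.
  apply: eq_bilinear_mx => v' w'; have := real_F v' w' Ux.
  rewrite (DF v' Ux) (DF w' Ux) mulmx0 mul0mx => e.
  by rewrite [RHS]mxE -[RHS]e /inner trmx_mul !mulmxA.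
by rewrite cJ tE -3!(mulmxA t) PJP mulmx0.
Qed.

Lemma cov_tangent_JH x v : U x -> cov g T v x = shape g h F N x v.
Proof.
move=> Ux; apply: (cov_tangent_part oU oW sg sh sF FW gsym gunit hsym hunit iso) => //.
exact: cov_along_JH_normal.
Qed.

Lemma cov_tangent_JH_sym x v w : U x ->
  (cov g T v x *m g x *m w^T) 0 0 = (cov g T w x *m g x *m v^T) 0 0.
Proof.
move=> Ux; rewrite !cov_tangent_JH //.
apply: (shape_sym oU oW sg sh sF FW gsym gunit hsym hunit iso) => //.
exact: normal_JH.
Qed.

(** The trace of A_N is 2<H, N> = 2<H, JH> - 2<H, T> = 0. *)
Lemma div_tangent_JH x : U x -> \sum_i cov g T (frame R i) x 0 i = 0.
Proof.
move=> Ux; have Wx := FW Ux.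
under eq_bigr => i _ do rewrite cov_tangent_JH //.
rewrite (trace_shape h F gsym N Ux); apply/eqP; rewrite mulf_eq0; apply/orP; right.
apply/eqP; rewrite /inner (normal_partE g h sF _ Ux) linearB /= mulmxBr.
have HP : H x *m h (F x) *m (P x)^T = 0.
  exact: (mean_curvature_normal sF gunit iso).
rewrite [(_ *m P x)^T]trmx_mul (mulmxA _ (P x)^T) HP mul0mx subr0.
rewrite /JH trmx_mul mulmxA -(mulmxA (H x)).
have : (H x *m (h (F x) *m J^T) *m (H x)^T) 0 0 =
    - (H x *m (h (F x) *m J^T) *m (H x)^T) 0 0.
  rewrite [LHS]bilinear_trmx trmx_mul trmxK (hsym Wx) (gram_J_skew JJ hJ Wx).
  by rewrite mulmxN mulNmx mxE.
lra.
Qed.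

Lemma smooth_on_tangent_JH : smooth_on U T.
Proof.
exact: (smooth_on_tangent_part oU oW sg sh sF FW gunit sJH).
Qed.

End TotallyReal.

(** * From charts to the surface *)

Lemma posdef_unitmx (R : realFieldType) m (A : 'M[R]_m) :
  (forall v : 'rV_m, v != 0 -> 0 < (v *m A *m v^T) 0 0) -> A \in unitmx.
Proof.
move=> pA; rewrite -row_free_unit -kermx_eq0; apply/rowV0P => v /sub_kermxP vA.
by apply/eqP; apply: contraT => /pA; rewrite vA mul0mx mxE ltxx.
Qed.

Lemma Jmx_sqr (R : realType) n : Jmx R n *m Jmx R n = - 1%:M.
Proof.
rewrite /Jmx mulmx_block !mulmx0 !mul0mx !mulmx1 mul1mx !(add0r, addr0).
by rewrite (scalar_mx_block n n) opp_block_mx oppr0.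
Qed.

Lemma open_local_dom (R : realType) n (M : surface R) (N : kahler R n)
  (f : isometric_immersion M N) a b : open (local_dom f a b).
Proof.
rewrite openE => x [aa ab ax bx].
have na : nbhs x (img a) by apply: open_nbhs_nbhs; split=> //; exact: img_open.
have nb : \forall y \near x, dom b (f (param a y)).
  have c : {for x, continuous (f \o param a)}.
    apply: continuous_comp; first exact: param_continuous.
    exact: immersion_continuous.
  by apply: c; apply: open_nbhs_nbhs; split=> //; exact: dom_open.
by apply: filterS2 na nb => y ay bY; split.
Qed.

Theorem theorem3p9 (R : realType) (n : nat) (c : R) (N : kahler R n)
    (M : surface R) (f : isometric_immersion M N)
    (N_space_form : complex_space_form N c)
    (f_PMC : PMC f)
    (f_totally_real : totally_real f)
    (H_nonzero : forall a b x, local_dom f a b x -> H_field f a b x != 0) :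
  (forall a b x v, local_dom f a b x ->
     cov (surface_metric M a) (T_field f a b) v x = A_N f a b x v) /\
  (forall a b x, local_dom f a b x ->
     - (2^-1 * laplacian (surface_metric M a)
          (fun y => normsq (surface_metric M a) y (T_field f a b y)) x)
     = gauss_curvature a x * normsq (surface_metric M a) x (T_field f a b x)
       + normsq_end (surface_metric M a) x (A_N f a b x)).
Proof.
suff main a b (aa : atlas a) (ab : atlas b) :
  (forall x v, local_dom f a b x ->
     cov (surface_metric M a) (T_field f a b) v x = A_N f a b x v) /\
  (forall x, local_dom f a b x ->
     - (2^-1 * laplacian (surface_metric M a)
          (fun y => normsq (surface_metric M a) y (T_field f a b y)) x)
     = gauss_curvature a x * normsq (surface_metric M a) x (T_field f a b x)
       + normsq_end (surface_metric M a) x (A_N f a b x)).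
  split=> [a b x v dx|a b x dx]; case: (dx) => aa ab _ _.
    exact: (main a b aa ab).1.
  exact: (main a b aa ab).2.
pose U := local_dom f a b; pose W := img b.
have oU : open U by exact: open_local_dom.
have oW : open W by exact: img_open.
have sg : smooth_on U (surface_metric M a).
  by apply: smooth_on_sub (gram_smooth _ aa) => x [].
have sh : smooth_on W (kahler_metric N b) by exact: gram_smooth.
have sF : smooth_on U (local_expr f a b) by exact: immersion_smooth.
have FW x : U x -> W (local_expr f a b x) by case=> _ _ _ /coord_img.
have gsym x : U x -> (surface_metric M a x)^T = surface_metric M a x.
  by case=> _ _ ax _; exact: gram_sym.
have gunit x : U x -> surface_metric M a x \in unitmx.
  by case=> _ _ ax _; apply: posdef_unitmx => v; exact: gram_pos.
have hsym y : W y -> (kahler_metric N b y)^T = kahler_metric N b y.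
  exact: gram_sym.
have hunit y : W y -> kahler_metric N b y \in unitmx.
  by move=> Wy; apply: posdef_unitmx => v; exact: gram_pos.
have iso x v w (Ux : U x) := immersion_isometric v w Ux.
have hJ y v w (Wy : W y) := kahler_hermitian v w ab Wy.
have dJ y u v w (Wy : W y) := kahler_closed u v w ab Wy.
have rF x v w (Ux : U x) := f_totally_real a b x v w Ux.
have pH x v (Ux : U x) := f_PMC a b x v Ux.
have covT x v : U x -> cov (surface_metric M a) (T_field f a b) v x = A_N f a b x v.
  exact: (cov_tangent_JH oU oW sg sh sF FW gsym gunit hsym hunit iso (Jmx_sqr R n) hJ dJ rF pH).
split=> // x Ux.
have cl := cov_tangent_JH_sym oU oW sg sh sF FW gsym gunit hsym hunit iso (Jmx_sqr R n) hJ dJ rF pH.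
have dv := div_tangent_JH oU oW sg sh sF FW gsym gunit hsym hunit iso (Jmx_sqr R n) hJ dJ rF pH.
have sT := smooth_on_tangent_JH (Jmx R n) oU oW sg sh sF FW gsym gunit hsym hunit iso.
rewrite (bochner_surface oU sg sT gsym gunit cl dv Ux); congr (_ + _).
by apply: eq_bigr => i _; apply: eq_bigr => j _; rewrite !covT.
Qed.
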